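(* Let $u$ be the optimal value function and $\theta^*$ the optimal control function defined in the context. The control function of the optimal process satisfies $$\theta^*(z)=\frac1{\sqrt2}+\frac1{12z}+O(z^{-2}),\qquad z\to\infty,$$ and, for some constant $c^*\in\mathbb R$, the expected number of jumps $u(z)$ of the optimal process started at $z$ has the expansion $$u(z)=\sqrt2\,z-\frac16\log z+c^*+\frac{\sqrt2}{144\,z}+O(z^{-2}),\qquad z\to\infty.$$
   Context: Controlled process. Let $\theta:(0,\infty)\to(0,\infty)$ satisfy $0<\theta(z)\le z$ and put $\lambda(z)=\theta(z)-\frac{\theta^2(z)}{2z}$. The piecewise deterministic Markov process on $[0,\infty)$ with control function $\theta$, denoted $Z|z$ when started at $z$, is defined by: (i) it decreases continuously with unit speed; (ii) jumps are negative and occur at rate $4\lambda(z)$ in state $z>0$; (iii) if a jump from state $z$ occurs, the jump size (downwards) has density $y\mapsto(1-y/z)/\lambda(z)$ on $[0,\theta(z)]$; (iv) the process terminates upon reaching $0$. Let $N_\theta(z)$ be the number of jumps of $Z|z$ with control function $\theta$. Optimal value and control. The function $u$ is the maximal expected number of jumps, $u(z)=\sup_\theta\mathbb E N_\theta(z)$. It is the solution on $[0,\infty)$ of $$u'(z)=4\int_0^z\big(u(z-y)+1-u(z)\big)_+\,(1-y/z)\,dy,\qquad u(0)=0,$$ where $a_+=\max(a,0)$. (Equivalently $u(z)=v(z^2)$, where $v(t)$ is the maximal expected length of an increasing subsequence that can be selected by an online strategy from a unit-rate Poisson random measure in $[0,t]\times[0,1]$.) The optimal control function is $\theta^*(z)=z$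 if $u(z)\le1$, and otherwise $\theta^*(z)$ is the unique solution $y\in[0,z]$ of $u(z-y)+1-u(z)=0$. The optimal process is the process above with control function $\theta^*$, so that $u(z)=\mathbb E N_{\theta^*}(z)$. *)

(* Defs.v *)
From mathcomp Require Import all_boot all_order all_algebra.
From mathcomp Require Import all_classical all_reals all_analysis.

Set Implicit Arguments.
Unset Strict Implicit.
Unset Printing Implicit Defensive.

Import Order.TTheory GRing.Theory Num.Theory.
Import numFieldNormedType.Exports.

Local Open Scope classical_set_scope.
Local Open Scope ring_scope.

(* Landau notations need a packaged filter. *)
Canonical pinfty_filter_on (R : numFieldType) :=
  FilterType (pinfty_nbhs R) _.

(* The controlled process is given by the law of its embedded jump chain: [theta]
   yields the sub-Markov kernel that sends a state to the state right after the
   next jump, its missing mass being the probability of reaching 0 without a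
   jump.  Only the values of [theta] on (0, +oo) are ever used. *)

(* Measurability is what makes the process well defined. *)
Definition control_function (R : realType) (theta : R -> R) : Prop :=
  measurable_fun (`]0, +oo[ : set R) theta /\
  forall z, 0 < z -> 0 < theta z <= z.

Definition lambda (R : realType) (theta : R -> R) (z : R) : R :=
  theta z - theta z ^+ 2 / (2 * z).

Definition jump_rate (R : realType) (theta : R -> R) (z : R) : R :=
  4 * lambda theta z.

Definition jump_density (R : realType) (theta : R -> R) (z y : R) : R :=
  (1 - y / z) / lambda theta z.

(* Probability that the process started at [z] descends to [x] without a jump;
   as the descent has unit speed, time is measured by the state itself. *)
Definition survival (R : realType) (theta : R -> R) (z x : R) : R :=
  expR (- \int[lebesgue_measure]_(s in `[x, z]) jump_rate theta s).

(* Expectation of [f (state after the first jump)] on the event that the process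
   started at [z] jumps before reaching 0.  The first jump occurs from a state
   x in (0, z] distributed with density [jump_rate theta x * survival theta z x]
   and leads to x - y. *)
Definition jump_kernel (R : realType) (theta : R -> R)
    (f : R -> \bar R) (z : R) : \bar R :=
  (\int[lebesgue_measure]_(x in `]0%R, z])
     ((jump_rate theta x * survival theta z x)%:E *
      \int[lebesgue_measure]_(y in `[0%R, theta x])
         (f (x - y)%R * (jump_density theta x y)%:E)))%E.

(* P(N_theta(z) >= n) *)
Definition prob_jumps_ge (R : realType) (theta : R -> R) (n : nat) :
    R -> \bar R :=
  iter n (jump_kernel theta) (cst 1%E).

(* E N = \sum_(n >= 1) P(N >= n) *)
Definition expected_jumps (R : realType) (theta : R -> R) (z : R) : \bar R :=
  (\sum_(1 <= n <oo) prob_jumps_ge theta n z)%E.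

(* The supremum is finite, as the jump rate at x is at most 2 * x, whence
   at most z ^+ 2 expected jumps: [fine] loses nothing. *)
Definition optimal_value (R : realType) (z : R) : R :=
  fine (ereal_sup [set expected_jumps theta z |
                   theta in [set theta | control_function theta]]).

(* In the second case the equation has exactly one solution in [0, z]. *)
Definition optimal_control (R : realType) (z : R) : R :=
  if optimal_value z <= 1 then z
  else xget z [set y | 0 <= y <= z /\
                       optimal_value (z - y) + 1 - optimal_value z = 0].

(* Main.v *)
Require Import Defs.
From mathcomp Require Import all_boot all_order all_algebra.
From mathcomp Require Import all_classical all_reals all_analysis.
From mathcomp Require Import measurable_realfun ring lra.

Set Implicit Arguments.
Unset Strict Implicit.
Unset Printing Implicit Defensive.

Import Order.TTheory GRing.Theory Num.Theory.
Import numFieldNormedType.Exports.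

Local Open Scope classical_set_scope.
Local Open Scope ring_scope.

(* The equation w' = [drift w], w(0) = 0, is solved by Picard iteration.  For any
   control, the process gains at most [drift w] per unit of time from the reward
   1 + w, with equality for the control that jumps exactly when w(z - y) + 1 >= w(z);
   hence w dominates every mean number of jumps, and the optimal control attains it
   because the remainder w - E[min(N, n)] is at most w(z) P(N >= n) on [0, z].

   For the asymptotics let g(z) = sqrt 2 z - ln z / 6 + sqrt 2 / (144 z).  A second
   order expansion shows that g solves the equation up to O(z^-3).  As the positive
   part is monotone and 1-Lipschitz, d = w - g obeys a perturbed maximum principle:
   if m <= d <= M on the window [z - A, z], then
     - 4 A (d(z) - m) - O(z^-3) <= d'(z) <= 4 A (M - d(z)) + O(z^-3).
   Hence d is bounded, the oscillation of d on a window contracts by a fixed factor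
   from one window to the next, up to O(z^-3), and so is itself O(z^-3).  Thus
   d' = O(z^-3) and d = c + O(z^-2).  The threshold expansion follows by inserting
   this into w(z) - w(z - y) = 1. *)

(** * Integrals of locally bounded functions *)

(** A control is merely measurable, so the mean number of jumps need not be differentiable at every
    [z]. The verification is therefore kept in integrated form: the jump chain becomes an operator
    on continuous functions, and the equation for [w] enters through an integrating factor. In the
    asymptotics the threshold is not located beforehand. As a function of the threshold [T], the
    approximate profit is maximal near 1/sqrt 2 + 1/(12 z), and its loss is quadratic in the
    deviation. The upper estimate may thus admit every [T] and the lower one may use an approximate
    optimum, both at a cost of O(z^-3). The drift at [z] sees the whole past, and the influence of
    [d] grows with the window length [A]. So [d] is first bounded at running extrema, where this
    influence vanishes; the bound then shows that jumps longer than a fixed [A] never pay, which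
    makes windows of fixed length possible. One order more than the final O(z^-2) is carried because
    integrating d' loses one power of [z]. *)

Section Integration.
Variable R : realType.
Implicit Types (f g : R -> R) (a b c x y z : R).
Local Notation mu := (@lebesgue_measure R).

(** Jump rates are only measurable, and integrability is not stable under products. This class is,
    and it gives integrability on every compact interval. *)
Definition locally_bounded_measurable f :=
  measurable_fun [set: R] f /\
  forall B : R, exists C : R, forall x, `|x| <= B -> `|f x| <= C.
Local Notation lbm := locally_bounded_measurable.

(** There is no sign convention: the value is 0 for [b <= a], so that primitives based at 0 vanish
    on the negative half line. *)
Definition integ f a b := \int[mu]_(x in `[a, b]) f x.

Lemma lbm_continuous f : continuous f -> lbm f.
Proof.
move=> cf; split; first exact: continuous_measurable_fun.
move=> B; have [B0|B0] := leP 0 B; last first.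
  by exists 0 => x xB; move: (le_lt_trans (le_trans (normr_ge0 x) xB) B0); rewrite ltxx.
have cn : {within `[- B, B], continuous (fun x => `|f x|)}.
  apply: continuous_subspaceT => x.
  exact: (continuous_comp (cf x) (@norm_continuous _ _ (f x))).
have [|c _ Hc] := EVT_max _ cn; first by rewrite ge0_cp.
by exists `|f c| => x; rewrite ler_norml => xB; apply: Hc; rewrite in_itv.
Qed.

Lemma lbm_cst c : lbm (fun=> c).
Proof. by apply: lbm_continuous => x; exact: cvg_cst. Qed.

Lemma lbm_id : lbm id.
Proof. by apply: lbm_continuous => x; exact: cvg_id. Qed.

Lemma lbmD f g : lbm f -> lbm g -> lbm (fun x => f x + g x).
Proof.
move=> [mf bf] [mg bg]; split; first exact: measurable_funD.
move=> B; have [C1 H1] := bf B; have [C2 H2] := bg B.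
by exists (C1 + C2) => x xB; rewrite (le_trans (ler_normD _ _))// lerD ?H1 ?H2.
Qed.

Lemma lbmM f g : lbm f -> lbm g -> lbm (fun x => f x * g x).
Proof.
move=> [mf bf] [mg bg]; split; first exact: measurable_funM.
move=> B; have [C1 H1] := bf B; have [C2 H2] := bg B.
by exists (C1 * C2) => x xB; rewrite normrM ler_pM ?H1 ?H2.
Qed.

Lemma lbmN f : lbm f -> lbm (fun x => - f x).
Proof.
move=> lf; have := lbmM (lbm_cst (-1)) lf.
by under eq_fun do rewrite mulN1r.
Qed.

Lemma lbmB f g : lbm f -> lbm g -> lbm (fun x => f x - g x).
Proof. by move=> lf lg; apply: lbmD => //; exact: lbmN. Qed.

Lemma lbm_integrable f a b : lbm f -> mu.-integrable `[a, b] (EFin \o f).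
Proof.
move=> [mf bf]; apply: measurable_bounded_integrable => //.
- have /= := lebesgue_measure_itv `[a, b]; rewrite /= => ->.
  by case: ifPn => // _; rewrite -EFinB ltry.
- exact: measurable_funTS.
- have [C HC] := bf (Num.max `|a| `|b|).
  exists C; split; first exact: num_real.
  move=> x Cx y /=; rewrite in_itv /= => /andP[ay yb].
  apply: le_trans (ltW Cx); apply: HC.
  rewrite le_max; have [y0|y0] := leP 0 y.
    by apply/orP; right; rewrite ger0_norm// (le_trans yb) ?ler_norm.
  apply/orP; left; rewrite ltr0_norm// lerNl (le_trans _ ay)//.
  by rewrite lerNl -normrN ler_norm.
Qed.

Lemma integ_point f a : integ f a a = 0.
Proof. by rewrite /integ set_itv1 Rintegral_set1. Qed.

Lemma integ_empty f a b : b <= a -> integ f a b = 0.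
Proof.
rewrite le_eqVlt => /predU1P[->|ba]; first exact: integ_point.
by rewrite /integ set_itv_ge ?Rintegral_set0// bnd_simp -ltNge.
Qed.

Lemma integ_eq f g a b : (forall x, a <= x <= b -> f x = g x) ->
  integ f a b = integ g a b.
Proof. by move=> fg; apply: eq_Rintegral => x; rewrite inE /= in_itv /= => /fg. Qed.

Lemma integ_le f g a b : lbm f -> lbm g ->
  (forall x, a <= x <= b -> f x <= g x) -> integ f a b <= integ g a b.
Proof.
by move=> lf lg fg; apply: le_Rintegral => //; exact: lbm_integrable.
Qed.

Lemma integ_ge0 f a b : (forall x, a <= x <= b -> 0 <= f x) -> 0 <= integ f a b.
Proof. by move=> f0; apply: Rintegral_ge0 => x /=; rewrite in_itv /= => /f0. Qed.

Lemma integ_cat f a b c : lbm f -> a <= b <= c ->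
  integ f a c = integ f a b + integ f b c.
Proof.
move=> lf /andP[ab bc].
have := @Rintegral_itvB R f (BLeft a) (BRight c) b.
rewrite !bnd_simp => /(_ (lbm_integrable a c lf) ab bc) /eqP.
rewrite subr_eq addrC => /eqP; rewrite /integ => ->; congr (_ + _).
apply: Rintegral_itv_obnd_cbnd; apply: integrableS (lbm_integrable b c lf) => //.
by apply: subset_itvr; rewrite bnd_simp.
Qed.

Lemma integD f g a b : lbm f -> lbm g ->
  integ (fun x => f x + g x) a b = integ f a b + integ g a b.
Proof. by move=> lf lg; apply: RintegralD => //; exact: lbm_integrable. Qed.

Lemma integB f g a b : lbm f -> lbm g ->
  integ (fun x => f x - g x) a b = integ f a b - integ g a b.
Proof. by move=> lf lg; apply: RintegralB => //; exact: lbm_integrable. Qed.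

Lemma integZ k f a b : lbm f -> integ (fun x => k * f x) a b = k * integ f a b.
Proof. by move=> lf; apply: RintegralZl => //; exact: lbm_integrable. Qed.

Lemma integ_cst k a b : a <= b -> integ (fun=> k) a b = k * (b - a).
Proof.
move=> ab; rewrite /integ Rintegral_cst//.
have /= := lebesgue_measure_itv `[a, b]; rewrite /= => ->.
move: ab; rewrite le_eqVlt => /predU1P[->|ab]; first by rewrite lte_fin ltxx subrr.
by rewrite lte_fin ab.
Qed.

Lemma integ_norm_le f a b C : lbm f -> a <= b ->
  (forall x, a <= x <= b -> `|f x| <= C) -> `|integ f a b| <= C * (b - a).
Proof.
move=> lf ab fC; rewrite ler_norml -mulNr -!integ_cst//; apply/andP; split.
  by apply: integ_le => //; [exact: lbm_cst|move=> x /fC; rewrite ler_norml => /andP[]].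
by apply: integ_le => //; [exact: lbm_cst|move=> x /fC; rewrite ler_norml => /andP[]].
Qed.

Lemma integ_FTC2 f F a b : a <= b -> continuous f ->
  (forall x, a <= x <= b -> is_derive x 1 F (f x)) -> integ f a b = F b - F a.
Proof.
rewrite le_eqVlt => /predU1P[<- _ _|ab cf dF]; first by rewrite integ_point subrr.
rewrite /integ /Rintegral (@continuous_FTC2 _ f F)//.
- exact: continuous_subspaceT.
- have cF x : a <= x <= b -> {for x, continuous F}.
    by move=> /dF[dFx _]; apply: differentiable_continuous; exact/derivable1_diffP.
  split.
  + by move=> x; rewrite in_itv /= => /andP[/ltW ax /ltW xb]; case: (dF x); rewrite ?ax.
  + by apply: cvg_at_right_filter; apply: cF; rewrite lexx ltW.
  + by apply: cvg_at_left_filter; apply: cF; rewrite lexx ltW.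
- move=> x; rewrite in_itv /= => /andP[/ltW ax /ltW xb].
  by rewrite derive1E; apply: derive_val; apply: dF; rewrite ax.
Qed.

Lemma integ_derive f a x : lbm f -> {for x, continuous f} -> a < x ->
  is_derive x 1 (integ f a) (f x).
Proof.
move=> lf cf ax.
have x1 : x < x + 1 by rewrite ltrDl.
have [] := @continuous_FTC1_closed _ f a x (x + 1) x1 (lbm_integrable a _ lf) ax cf.
by move=> dF; rewrite derive1E => <-; exact: DeriveDef.
Qed.

Lemma locally_lipschitz_continuous f :
  (forall B : R, exists C : R, forall x y, `|x| <= B -> `|y| <= B ->
    `|f x - f y| <= C * `|x - y|) -> continuous f.
Proof.
move=> Hf x; have [C HC] := Hf (`|x| + 1).
apply/cvgrPdist_le => e e0; near=> y.
have xy : `|x - y| <= Num.min 1 (e / (`|C| + 1)).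
  near: y; apply: cvgr_dist_le => //.
  by rewrite lt_min ltr01 divr_gt0// ltr_wpDl.
move: xy; rewrite le_min => /andP[xy1 xye].
have yB : `|y| <= `|x| + 1.
  rewrite -{1}(subrK x y) addrC (le_trans (ler_normD _ _))// lerD2l distrC //.
apply: (le_trans (HC x y _ yB)); first by rewrite lerDl.
rewrite (@le_trans _ _ ((`|C| + 1) * `|x - y|))//.
  by rewrite ler_wpM2r// (le_trans (ler_norm _))// lerDl.
by rewrite mulrC -ler_pdivlMr// ltr_wpDl.
Unshelve. all: by end_near. Qed.

Lemma integ_continuous f a : lbm f -> continuous (integ f a).
Proof.
move=> lf; apply: locally_lipschitz_continuous => B.
have [C HC] := lf.2 (Num.max B `|a|).
have H x y : `|x| <= B -> `|y| <= B -> x <= y ->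
    `|integ f a x - integ f a y| <= `|C| * `|x - y|.
  move=> xB yB xy; have [ya|ay] := leP y a.
    by rewrite !integ_empty// ?(le_trans xy)// subrr normr0 mulr_ge0.
  have bC z : a <= z <= y -> `|f z| <= `|C|.
    move=> /andP[az zy]; apply: le_trans (ler_norm C); apply: HC.
    rewrite le_max; have [z0|z0] := leP 0 z.
      by rewrite ger0_norm// (le_trans zy)// (le_trans (ler_norm y)).
    apply/orP; right; rewrite ltr0_norm// lerNl (le_trans _ az)//.
    by rewrite lerNl -normrN ler_norm.
  rewrite (distrC x y) [`|y - x|]ger0_norm ?subr_ge0//.
  have [xa|ax] := leP x a.
    rewrite (integ_empty _ xa) sub0r normrN.
    apply: (le_trans (integ_norm_le lf (ltW ay) bC)).
    by rewrite ler_wpM2l// lerD2l lerN2.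
  rewrite (@integ_cat f a x y)//; last by rewrite ltW.
  rewrite opprD addNKr normrN; apply: integ_norm_le => // z /andP[xz zy].
  by apply: bC; rewrite (le_trans (ltW ax)).
exists `|C| => x y xB yB; have [xy|/ltW yx] := leP x y; first exact: H.
by rewrite distrC (distrC x); exact: H.
Qed.

Lemma integ_shift f z c : continuous f -> 0 <= c ->
  integ (fun y => f (z - y)) 0 c = integ f (z - c) z.
Proof.
move=> cf c0; have lf := lbm_continuous cf.
(* The base point lies strictly below [z - c], because [integ_derive] needs it strictly to the left
   of every point of differentiation. *)
pose a := z - c - 1; pose F y := - integ f a (z - y).
have cg : continuous (fun y => f (z - y)).
  move=> y; apply: continuous_comp; last exact: cf.
  by apply: cvgB; [exact: cvg_cst|exact: cvg_id].
have dF y : 0 <= y <= c -> is_derive y 1 F (f (z - y)).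
  move=> /andP[y0 yc].
  have dl : is_derive y (1:R) (fun y => z - y) (- 1).
    by apply: is_derive_eq; rewrite add0r mul1r.
  have ay : a < z - y by rewrite /a; lra.
  have dI := integ_derive lf (cf (z - y)) ay.
  have := is_deriveN (@is_derive1_comp _ (integ f a) (fun y => z - y) y _ _ dI dl).
  by rewrite mulrN1 opprK.
rewrite (integ_FTC2 c0 cg dF) /F subr0 opprK addrC (@integ_cat f a (z - c) z)//.
  by rewrite addrC addKr.
by rewrite /a; lra.
Qed.

Lemma pos_lip x y : `|Num.max x 0 - Num.max y 0| <= `|x - y|.
Proof.
rewrite !maxEge; case: ifPn; case: ifPn; rewrite -?ltNge => Hy Hx; rewrite ?subrr ?normr0//.
  by rewrite subr0 !ger0_norm; lra.
by rewrite sub0r normrN ger0_norm// ler0_norm; lra.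
Qed.

Lemma continuous_pos f : continuous f -> continuous (fun x => Num.max (f x) 0).
Proof.
move=> cf x; apply/cvgrPdist_le => e e0; near=> y.
apply: (le_trans (pos_lip _ _)); near: y.
by move/cvgrPdist_le : (cf x); apply.
Unshelve. all: by end_near. Qed.

End Integration.

(** * Derivatives and barriers *)

Section RealAnalysis.
Variable R : realType.
Implicit Types (f g : R -> R) (a b c k x y z : R).

(** The rules below are restated for explicit functions of [t], so that the derivative of a compound
    expression can be assembled as a term. *)
Lemma derive_cst k x : is_derive x (1 : R) (fun=> k) 0.
Proof. exact: is_derive_cst. Qed.

Lemma derive_id x : is_derive x (1 : R) id 1.
Proof. exact: is_derive_id. Qed.

Lemma derive_add f g x a b : is_derive x (1 : R) f a -> is_derive x (1 : R) g b ->
  is_derive x (1 : R) (fun t => f t + g t) (a + b).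
Proof. by move=> df dg; exact: is_deriveD. Qed.

Lemma derive_sub f g x a b : is_derive x (1 : R) f a -> is_derive x (1 : R) g b ->
  is_derive x (1 : R) (fun t => f t - g t) (a - b).
Proof. by move=> df dg; exact: is_deriveB. Qed.

Lemma derive_scale k f x a : is_derive x (1 : R) f a ->
  is_derive x (1 : R) (fun t => k * f t) (k * a).
Proof. by move=> df; exact: (is_deriveZ k). Qed.

Lemma derive_opp f x a : is_derive x (1 : R) f a ->
  is_derive x (1 : R) (fun t => - f t) (- a).
Proof. by move=> df; exact: is_deriveN. Qed.

Lemma derive_mul f g x a b : is_derive x (1 : R) f a -> is_derive x (1 : R) g b ->
  is_derive x (1 : R) (fun t => f t * g t) (a * g x + f x * b).
Proof.
move=> df dg; apply: (is_derive_eq (is_deriveM df dg)).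
by rewrite /GRing.scale /= addrC mulrC.
Qed.

Lemma derive_exp n x : is_derive x (1 : R) (fun t : R => t ^+ n) (n%:R * x ^+ n.-1).
Proof.
elim: n => [|n IH].
  by rewrite mul0r; under eq_fun do rewrite expr0; exact: derive_cst.
under eq_fun do rewrite exprS.
apply: (is_derive_eq (derive_mul (derive_id x) IH)).
by case: n {IH} => [|n] /=; [ring|rewrite exprS; ring].
Qed.

Lemma derive_inv x : x != 0 -> is_derive x (1 : R) (fun t : R => t^-1) (- x ^- 2).
Proof.
move=> x0; apply: (is_derive_eq (@is_deriveV _ (fun t : R => t) x 1 1 x0 (derive_id x))).
by rewrite /GRing.scale /= mulr1.
Qed.

Lemma derive_comp f g x a b : is_derive (g x) (1 : R) f a -> is_derive x (1 : R) g b ->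
  is_derive x (1 : R) (fun t => f (g t)) (a * b).
Proof. by move=> df dg; exact: is_derive1_comp. Qed.

Lemma derive_continuous f x a : is_derive x (1 : R) f a -> {for x, continuous f}.
Proof. by case=> dfx _; apply: differentiable_continuous; exact/derivable1_diffP. Qed.

Lemma derive_mono f df a b : a <= b -> {within `[a, b], continuous f} ->
  (forall x, a < x < b -> is_derive x (1 : R) f (df x)) ->
  (forall x, a < x < b -> 0 <= df x) -> f a <= f b.
Proof.
move=> ab cf dF df0.
apply: (@ger0_derive1_le_cc _ f a b) => //.
- by move=> x; rewrite in_itv /= => /dF[].
- move=> x; rewrite in_itv /= => xab.
  by rewrite derive1E (@derive_val _ _ _ _ _ _ _ (dF _ xab)); exact: df0.
- by rewrite in_itv /= lexx.
- by rewrite in_itv /= lexx ab.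
Qed.

Lemma derive_mono_cc f df a b : a <= b ->
  (forall x, a <= x <= b -> is_derive x (1 : R) f (df x)) ->
  (forall x, a <= x <= b -> 0 <= df x) -> f a <= f b.
Proof.
move=> ab dF df0; apply: (@derive_mono f df) => //.
- apply: continuous_in_subspaceT => x; rewrite inE /= in_itv /= => xab.
  exact: derive_continuous (dF _ xab).
- by move=> x /andP[/ltW ? /ltW ?]; apply: dF; apply/andP.
- by move=> x /andP[/ltW ? /ltW ?]; apply: df0; apply/andP.
Qed.

Lemma right_of_pos_derive f x d : is_derive x (1 : R) f d -> f x = 0 -> 0 < d ->
  exists2 e, 0 < e & forall y, x <= y <= x + e -> 0 <= f y.
Proof.
move=> [dfx dE] fx0 d0.
move: dfx => /cvg_ex[l Hl]; have ld : l = d by rewrite -dE; apply/esym/cvg_lim.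
move: Hl; rewrite {}ld => /cvgrPdist_lt /(_ _ d0) [e /= e0 He].
exists (e / 2); first by rewrite divr_gt0.
move=> y /andP[xy yxe]; move: xy; rewrite le_eqVlt => /predU1P[<-|xy]; first by rewrite fx0.
have yx0 : 0 < y - x by rewrite subr_gt0.
have := He (y - x); rewrite /ball_ /= sub0r normrN gtr0_norm//.
have ye : y - x < e by lra.
rewrite gt_eqF// => /(_ ye isT).
rewrite fx0 subr0 [_ *: 1]mulr1 subrK => H.
have : 0 < (y - x)^-1 * f y by move: H; rewrite ltr_norml /GRing.scale /=; lra.
by rewrite pmulr_rgt0 ?invr_gt0// => /ltW.
Qed.

(* At the last point up to which [f] is nonnegative either [f > 0], or [f = 0]
   and [f] is increasing: either way it stays nonnegative a little longer. *)
Lemma barrier f a b : a <= b ->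
  (forall x, a <= x <= b -> {for x, continuous f}) -> 0 <= f a ->
  (forall x, a <= x < b -> f x = 0 -> (forall y, a <= y <= x -> 0 <= f y) ->
    exists2 d, 0 < d & is_derive x (1 : R) f d) ->
  forall x, a <= x <= b -> 0 <= f x.
Proof.
move=> ab cf fa0 Hf.
pose S := [set x | a <= x <= b /\ forall y, a <= y <= x -> 0 <= f y].
have Sa : S a.
  split; first by rewrite lexx.
  by move=> y ya; have -> : y = a by apply/eqP; rewrite eq_le andbC.
have ubS : ubound S b by move=> x [/andP[]].
have hS : has_sup S by split; [exists a|exists b].
set c := sup S.
have ac : a <= c by apply: ub_le_sup; [exists b|].
have cb : c <= b by apply: ge_sup; [exists a|].
have below y : a <= y < c -> 0 <= f y.
  move=> /andP[ay yc]; have [x [_ Hx] yx] := sup_gt (ex_intro _ a Sa) yc.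
  by apply: Hx; rewrite ay ltW.
have fc : 0 <= f c.
  rewrite leNgt; apply/negP => fc0.
  have nfc : 0 < - f c by lra.
  have acb : a <= c <= b by rewrite ac.
  have /cvgrPdist_lt /(_ _ nfc) [e /= e0 He] := cf c acb.
  have ac' : a < c by rewrite lt_neqAle ac andbT; apply: contraTneq fc0 => <-; rewrite -leNgt.
  pose y := Num.max a (c - e / 2).
  have yc : y < c by rewrite gt_max ac'; lra.
  have y1 : c - e / 2 <= y by rewrite le_max lexx orbT.
  have y0 : a <= y < c by rewrite le_max lexx.
  have := He y; rewrite /ball_ /= gtr0_norm ?subr_gt0// => /(_ ltac:(lra)).
  by rewrite ltr_norml; have := below y y0; lra.
have [ecb|cb'] := eqVneq c b.
  move=> x /andP[ax xb]; move: xb; rewrite -ecb le_eqVlt => /predU1P[->//|xc].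
  by apply: below; rewrite ax.
have {}cb' : c < b by rewrite lt_neqAle cb'.
have fle y : a <= y <= c -> 0 <= f y.
  by move=> /andP[ay]; rewrite le_eqVlt => /predU1P[->//|yc]; apply: below; rewrite ay.
have [e e0 He] : exists2 e, 0 < e & forall y, c <= y <= c + e -> 0 <= f y.
  have [fcz|fcn] := eqVneq (f c) 0.
    have [d d0 dd] := Hf c (introT andP (conj ac cb')) fcz fle.
    exact: right_of_pos_derive dd fcz d0.
  have fcp : 0 < f c by rewrite lt_neqAle eq_sym fcn.
  have acb : a <= c <= b by rewrite ac.
  have /cvgrPdist_lt /(_ _ fcp) [e /= e0 He] := cf c acb.
  exists (e / 2); first by rewrite divr_gt0.
  move=> y ycd; have := He y; rewrite /ball_ /= distrC ger0_norm; last by lra.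
  by move=> /(_ ltac:(lra)); rewrite ltr_norml; lra.
pose x := Num.min b (c + e).
have cx : c < x by rewrite lt_min cb'; lra.
have Sx : S x.
  split; first by rewrite (le_trans ac (ltW cx)) ge_min lexx.
  move=> y /andP[ay yx]; have [yc|cy] := leP y c; first by apply: fle; rewrite ay.
  by apply: He; rewrite (ltW cy)/= (le_trans yx)// ge_min lexx orbT.
have : x <= c by apply: ub_le_sup => //; exists b.
by rewrite leNgt cx.
Qed.

(** The intervals [u n - e n, u n + e n] are nested, and the supremum of their left ends lies in all
    of them. The limit thus comes with its rate. *)
Lemma nested_limit (u e : nat -> R) : (forall n, 0 <= e n) ->
  (forall n, `|u n.+1 - u n| <= e n - e n.+1) ->
  exists l, forall n, `|u n - l| <= e n.
Proof.
move=> e0 H.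
have lo m n : (m <= n)%N -> u m - e m <= u n - e n.
  move=> /subnK <-; elim: (n - m)%N => // k IH; rewrite addSn (le_trans IH)//.
  by have := H (k + m)%N; rewrite ler_norml; lra.
have hi m n : (m <= n)%N -> u n + e n <= u m + e m.
  move=> /subnK <-; elim: (n - m)%N => // k IH; rewrite addSn (le_trans _ IH)//.
  by have := H (k + m)%N; rewrite ler_norml; lra.
pose A := [set u n - e n | n in [set: nat]].
have ubA n : ubound A (u n + e n).
  move=> _ [m _ <-]; have [mn|/ltnW nm] := leqP m n.
    by apply: (le_trans (lo _ _ mn)); have := e0 n; lra.
  by apply: le_trans (hi _ _ nm); have := e0 m; lra.
have A0 : A !=set0 by exists (u 0%N - e 0%N), 0%N.
exists (sup A) => n; rewrite ler_distlC; apply/andP; split.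
  by apply: ub_le_sup; [exists (u 0%N + e 0%N)|exists n].
exact: ge_sup.
Qed.

End RealAnalysis.

(** * The optimality equation *)

Section OptimalityEquation.
Variable R : realType.
Implicit Types (u v w : R -> R) (a b c k x y z : R).

(** The right-hand side of the optimality equation after the substitution x = z - y, where [x] is
    the state after the jump. *)
Definition drift w z :=
  4 / z * integ (fun x => x * Num.max (w x + 1 - w z) 0) 0 z.

(** A class stable under Picard iteration. The slope bound [2 * y] is the total rate of all jumps
    from [y], each of which is worth at most 1. *)
Definition value_like w :=
  [/\ forall x, x <= 0 -> w x = 0,
      forall x y, x <= y -> w x <= w y &
      forall x y, 0 <= x <= y -> w y - w x <= 2 * y * (y - x)].

Lemma integ_id a b : a <= b -> integ id a b = (b ^+ 2 - a ^+ 2) / 2.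
Proof.
move=> ab; have ci : continuous (@id R) by move=> x; exact: cvg_id.
have dF x : is_derive x (1 : R) (fun t => 2^-1 * t ^+ 2) x.
  by apply: (is_derive_eq (derive_scale _ (derive_exp 2 x))); rewrite /= expr1; field.
by rewrite (integ_FTC2 ab ci (fun x _ => dF x)); field.
Qed.

Lemma integ_norm_le_integ (f g : R -> R) a b :
  locally_bounded_measurable f -> locally_bounded_measurable g ->
  (forall x, a <= x <= b -> `|f x| <= g x) -> `|integ f a b| <= integ g a b.
Proof.
move=> lf lg fg; rewrite ler_norml; apply/andP; split.
  have := @integ_le _ (fun x => (-1) * g x) f a b (lbmM (lbm_cst (-1)) lg) lf.
  rewrite integZ// mulN1r; apply => x /fg; rewrite mulN1r ler_norml => /andP[].
  by [].
by apply: integ_le => // x /fg; rewrite ler_norml => /andP[].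
Qed.

Lemma value_like_lipschitz w B x y : value_like w -> `|x| <= B -> `|y| <= B ->
  `|w x - w y| <= 2 * B * `|x - y|.
Proof.
move=> [w0 wm wl].
suff H x' y' : `|x'| <= B -> `|y'| <= B -> x' <= y' -> w y' - w x' <= 2 * B * (y' - x').
  move=> xB yB; have [xy|/ltW yx] := leP x y.
    rewrite distrC (distrC x) !ger0_norm ?subr_ge0//; last exact: wm.
    exact: H.
  by rewrite !ger0_norm ?subr_ge0//; [exact: H|exact: wm].
move=> xB yB xy; have B0 : 0 <= B by rewrite (le_trans _ xB).
have yB' : y' <= B by rewrite (le_trans _ yB)// ler_norm.
have [y0|y0] := leP y' 0.
  by rewrite !w0// ?(le_trans xy)// subrr mulr_ge0 ?mulr_ge0// subr_ge0.
have [x0|x0] := leP 0 x'.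
  rewrite (le_trans (wl x' y' _))// ?x0// ler_wpM2r ?subr_ge0//.
  by rewrite ler_wpM2l.
have := wl 0 y'; rewrite lexx ltW// => /(_ isT).
rewrite (w0 x' (ltW x0)) (w0 0)// !subr0 => /le_trans; apply.
by apply: ler_pM; lra.
Qed.

Lemma value_like_continuous w : value_like w -> continuous w.
Proof.
move=> vw; apply: locally_lipschitz_continuous => B; exists (2 * B) => x y.
exact: value_like_lipschitz.
Qed.

Lemma reward_continuous w c : value_like w ->
  continuous (fun x => x * Num.max (w x + 1 - c) 0).
Proof.
move=> vw x; apply: cvgM; first exact: cvg_id.
apply: (@continuous_pos _ (fun x => w x + 1 - c)) => {}x; apply: cvgB; last exact: cvg_cst.
by apply: cvgD; [exact: value_like_continuous|exact: cvg_cst].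
Qed.

Lemma reward_lbm w c : value_like w ->
  locally_bounded_measurable (fun x => x * Num.max (w x + 1 - c) 0).
Proof. by move=> vw; apply: lbm_continuous; exact: reward_continuous. Qed.

Lemma drift_le0 w z : z <= 0 -> drift w z = 0.
Proof. by move=> z0; rewrite /drift integ_empty// mulr0. Qed.

Lemma reward_bound w z x : value_like w -> 0 <= x <= z ->
  0 <= x * Num.max (w x + 1 - w z) 0 <= x.
Proof.
move=> [_ wm _] /andP[x0 xz]; rewrite mulr_ge0 ?le_max ?lexx ?orbT//=.
by rewrite ler_piMr// ge_max ler01 andbT; have := wm _ _ xz; lra.
Qed.

Lemma drift_ge0 w z : value_like w -> 0 <= drift w z.
Proof.
move=> vw; have [z0|z0] := leP z 0; first by rewrite drift_le0.
have z4 : 0 <= 4 / z by rewrite divr_ge0// ltW.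
rewrite mulr_ge0//; apply: integ_ge0 => x xz.
by have /andP[] := reward_bound vw xz.
Qed.

Lemma drift_le w z : value_like w -> 0 <= z -> drift w z <= 2 * z.
Proof.
move=> vw; rewrite le_eqVlt => /predU1P[<-|z0]; first by rewrite drift_le0// mulr0.
rewrite (@le_trans _ _ (4 / z * integ id 0 z))//.
  have z4 : 0 <= 4 / z by rewrite divr_ge0// ltW.
  rewrite ler_wpM2l//; apply: integ_le => //.
  - exact: reward_lbm.
  - exact: lbm_id.
  - by move=> x xz; have /andP[] := reward_bound vw xz.
rewrite (integ_id (ltW z0)) le_eqVlt; apply/orP; left; apply/eqP; field.
by rewrite gt_eqF.
Qed.

(** The function enters the integrand twice, at [x] and at [z], whence an error [2 * d]; integrating
    [x] over [0, z] contributes z^2 / 2. *)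
Lemma drift_lip v w z d : value_like v -> value_like w -> 0 <= z -> 0 <= d ->
  (forall x, 0 <= x <= z -> `|v x - w x| <= d) ->
  `|drift v z - drift w z| <= 4 * z * d.
Proof.
move=> vv vw; rewrite le_eqVlt => /predU1P[<-|z0] d0 H.
  by rewrite !drift_le0// subrr normr0 mulr0 mul0r.
rewrite /drift -mulrBr -integB; [|exact: reward_lbm..].
have z4 : 0 <= 4 / z by rewrite divr_ge0// ltW.
rewrite normrM (ger0_norm z4).
rewrite (@le_trans _ _ (4 / z * integ (fun x => 2 * d * x) 0 z))//; last first.
  rewrite integZ; last exact: lbm_id.
  rewrite (integ_id (ltW z0)) le_eqVlt; apply/orP; left; apply/eqP; field.
  by rewrite gt_eqF.
rewrite ler_wpM2l//; apply: integ_norm_le_integ.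
- by apply: lbmB; exact: reward_lbm.
- by apply: lbmM; [exact: lbm_cst|exact: lbm_id].
- move=> x /andP[x0 xz]; rewrite -mulrBr normrM ger0_norm// mulrC ler_wpM2r//.
  rewrite (le_trans (pos_lip _ _))//.
  have := H x; rewrite x0 xz => /(_ isT); have := H z; rewrite lexx ltW// => /(_ isT).
  rewrite !ler_norml; lra.
Qed.

(** Both the upper limit and the integrand depend on [z]. The tail between the two limits costs [B]
    times the distance, the change of integrand [2 * B * B * B] times it. *)
Lemma reward_integ_continuous w : value_like w ->
  continuous (fun z => integ (fun x => x * Num.max (w x + 1 - w z) 0) 0 z).
Proof.
move=> vw; apply: locally_lipschitz_continuous => B.
pose J z := integ (fun x => x * Num.max (w x + 1 - w z) 0) 0 z.
exists (2 * B * B * B + B).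
suff H x y : `|x| <= B -> `|y| <= B -> x <= y ->
    `|J x - J y| <= (2 * B * B * B + B) * `|x - y|.
  move=> x y xB yB; have [xy|/ltW yx] := leP x y; first exact: H.
  by rewrite distrC (distrC x); exact: H.
move=> xB yB xy; have B0 : 0 <= B by rewrite (le_trans _ xB).
have yB' : y <= B by rewrite (le_trans _ yB)// ler_norm.
have nxy : `|x - y| = y - x by rewrite distrC ger0_norm ?subr_ge0.
have C0 : 0 <= 2 * B * B * B by rewrite !mulr_ge0.
have [y0|y0] := leP y 0.
  by rewrite /J !integ_empty// ?(le_trans xy)// subrr normr0 mulr_ge0// addr_ge0.
have tail a : 0 <= a <= y ->
    `|integ (fun s => s * Num.max (w s + 1 - w y) 0) a y| <= B * (y - a).
  move=> /andP[a0 ay]; apply: integ_norm_le => //; first exact: reward_lbm.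
  move=> s /andP[as_ sy]; have s0 : 0 <= s by rewrite (le_trans a0).
  have /andP[l r] : 0 <= s * Num.max (w s + 1 - w y) 0 <= s.
    by apply: reward_bound; rewrite ?s0.
  by rewrite ger0_norm//; lra.
have [x0|x0] := leP x 0.
  rewrite /J (integ_empty _ x0) sub0r normrN (le_trans (tail 0 _))//; first by rewrite lexx ltW.
  by rewrite nxy; apply: ler_pM; lra.
rewrite /J (@integ_cat _ (fun s => s * Num.max (w s + 1 - w y) 0) 0 x y); last 2 first.
- exact: reward_lbm.
- by rewrite ltW.
rewrite opprD addrA (le_trans (ler_normB _ _))// mulrDl lerD//; last first.
  by rewrite nxy; apply: tail; rewrite ltW.
rewrite -integB; [|exact: reward_lbm..].
apply: (@le_trans _ _ (B * (2 * B * `|x - y|) * (x - 0))); last first.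
  have xB' : x <= B by lra.
  have -> : 2 * B * B * B * `|x - y| = B * (2 * B * `|x - y|) * B by ring.
  by rewrite subr0 ler_wpM2l// !mulr_ge0.
apply: integ_norm_le; last 2 first.
- exact: ltW.
- move=> s /andP[s0 sx]; rewrite -mulrBr normrM ger0_norm// ler_pM//; first by lra.
  rewrite (le_trans (pos_lip _ _))//.
  have -> : w s + 1 - w x - (w s + 1 - w y) = - (w x - w y) by ring.
  by rewrite normrN; exact: value_like_lipschitz.
by apply: lbmB; exact: reward_lbm.
Qed.

Lemma drift_continuous w : value_like w -> continuous (drift w).
Proof.
move=> vw z; have [z0|z0|z0] := ltrgtP z 0.
- apply: (@near_cst_continuous _ _ 0) => //.
  by near=> y; apply: drift_le0; apply: ltW; near: y; exact: lt_nbhsl.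
- apply: cvgM; last exact: reward_integ_continuous.
  apply: cvgM; first exact: cvg_cst.
  by apply: cvgV; [rewrite gt_eqF|exact: cvg_id].
(* At 0 the factor [4 / z] is singular; continuity comes from the bounds 0 <= drift w y <= 2 y. *)
- rewrite z0; apply/cvgrPdist_le => e e0; near=> y.
  rewrite (drift_le0 _ (lexx 0)) sub0r normrN ger0_norm ?drift_ge0//.
  have ye : `|y| <= e / 2.
    near: y; have := @cvgr0_norm_le _ _ R (nbhs (0:R)) _ id cvg_id (e/2).
    by apply; rewrite divr_gt0.
  have [y0|y0] := leP y 0; first by rewrite drift_le0// ltW.
  rewrite (le_trans (drift_le vw (ltW y0)))//.
  by move: ye; rewrite gtr0_norm//; lra.
Unshelve. all: by end_near. Qed.

Lemma drift_lbm w : value_like w -> locally_bounded_measurable (drift w).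
Proof. by move=> vw; apply: lbm_continuous; exact: drift_continuous. Qed.

Lemma value_like_integ w : value_like w -> value_like (integ (drift w) 0).
Proof.
move=> vw; have incr x y : 0 <= x <= y ->
    integ (drift w) 0 y - integ (drift w) 0 x = integ (drift w) x y.
  move=> /andP[x0 xy]; rewrite (@integ_cat _ _ 0 x y) ?x0//; last exact: drift_lbm.
  by rewrite addrC addKr.
split.
- by move=> x x0; rewrite integ_empty.
- move=> x y xy; have [x0|x0] := leP x 0.
    by rewrite integ_empty//; apply: integ_ge0 => z _; exact: drift_ge0.
  have x0y : 0 <= x <= y by rewrite xy ltW.
  rewrite -subr_ge0 incr//; apply: integ_ge0 => z _; exact: drift_ge0.
- move=> x y /andP[x0 xy]; rewrite incr ?x0//.
  rewrite (le_trans (ler_norm _))//; apply: integ_norm_le => //; first exact: drift_lbm.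
  move=> z /andP[xz zy]; rewrite ger0_norm ?drift_ge0// (le_trans (drift_le vw _))//; lra.
Qed.

Fixpoint picard n : R -> R :=
  if n is n'.+1 then integ (drift (picard n')) 0 else fun=> 0.

Lemma picard_value_like n : value_like (picard n).
Proof.
elim: n => [|n IH]; last exact: value_like_integ.
split => //= x y /andP[x0 xy]; rewrite subrr !mulr_ge0 ?subr_ge0//; lra.
Qed.

(** In the norm weighted by exp(4 z^2) the Picard map halves distances on the whole half line: the
    Lipschitz constant [4 * x] of [drift_lip] times exp(4 x^2) has the primitive exp(4 x^2) / 2. *)
Lemma picard_step n z : 0 <= z ->
  `|picard n.+1 z - picard n z| <= 2 ^- n * expR (4 * z ^+ 2).
Proof.
elim: n z => [|n IH] z z0.
  rewrite /= subr0 expr0 invr1 mul1r.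
  have vw := picard_value_like 0.
  apply: (@le_trans _ _ (z * 2 * (z - 0))).
    apply: integ_norm_le => //; first exact: drift_lbm.
    move=> x /andP[x0 xz]; rewrite ger0_norm ?drift_ge0//.
    by rewrite (le_trans (drift_le vw x0))//; lra.
  have := expR_ge1Dx (4 * z ^+ 2); have : 0 <= z ^+ 2 by rewrite sqr_ge0.
  have -> : z * 2 * (z - 0) = 2 * z ^+ 2 by ring.
  by lra.
have vn := picard_value_like n; have vn1 := picard_value_like n.+1.
rewrite [picard n.+2]/= [X in _ - X z]/= -integB; [|exact: drift_lbm..].
pose G s : R := 2 ^- n.+1 * expR (4 * s ^+ 2).
pose g s : R := 2 ^- n.+1 * (expR (4 * s ^+ 2) * (4 * (2 * s))).
have dG x : is_derive x (1 : R) G (g x).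
  apply: derive_scale; apply: (derive_comp (f := expR) (g := fun s => 4 * s ^+ 2)).
    by apply: derive_scale; exact: derive_exp.
have cg : continuous g.
  move=> x; apply: (@derive_continuous _ _ _
    (2 ^- n.+1 * (expR (4 * x ^+ 2) * (4 * (2 * x)) * (4 * (2 * x)) +
      expR (4 * x ^+ 2) * (4 * (2 * 1))))).
  apply: derive_scale; apply: derive_mul.
    apply: (derive_comp (f := expR) (g := fun s => 4 * s ^+ 2)).
    by apply: derive_scale; exact: derive_exp.
apply: (@le_trans _ _ (integ g 0 z)); last first.
  rewrite (integ_FTC2 z0 cg (fun x _ => dG x)) /G lerBlDr lerDl mulr_ge0 ?expR_ge0//.
apply: integ_norm_le_integ.
- by apply: lbmB; exact: drift_lbm.
- exact: lbm_continuous.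
- move=> x /andP[x0 xz].
  apply: (@le_trans _ _ (4 * x * (2 ^- n * expR (4 * x ^+ 2)))).
    apply: drift_lip => //.
    move=> y /andP[y0 yx]; rewrite (le_trans (IH y y0))//.
    rewrite ler_wpM2l ?invr_ge0 ?exprn_ge0// ler_expR ler_wpM2l//.
    by rewrite ler_sqr ?nnegrE.
  rewrite /g [2 ^+ n.+1]exprS invfM le_eqVlt; apply/orP; left; apply/eqP; field.
  by rewrite expf_eq0 /= pnatr_eq0 andbF.
Qed.

Lemma le0_geometric a k : (forall n, a <= k * 2 ^- n) -> a <= 0.
Proof.
move=> H; rewrite leNgt; apply/negP => a0.
have k0 : 0 < k.
  have := H 0%N; rewrite expr0 invr1 mulr1; lra.
have [n Hn] := ltr_add_invr (y := 0) (x := a / k) (divr_gt0 a0 k0).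
move: Hn; rewrite add0r ltr_pdivlMr// => Hn.
have := H n.+1; apply/negP; rewrite -ltNge (le_lt_trans _ Hn)// mulrC ler_wpM2r ?(ltW k0)//.
rewrite lef_pV2 ?posrE ?exprn_gt0// -natrX ler_nat.
exact: ltnW (ltn_expl _ _).
Qed.

Lemma optimality_equation_solvable :
  exists2 w, value_like w & forall z, w z = integ (drift w) 0 z.
Proof.
(* The factor 2 sums the geometric series of the bounds in [picard_step]. *)
pose E z : R := 2 * expR (4 * z ^+ 2).
have E0 z : 0 <= E z by rewrite mulr_ge0 ?expR_ge0.
have p0 n : 0 <= (2 : R) ^- n by rewrite invr_ge0 exprn_ge0.
have /choice[w Hw] : forall z, exists l, forall n, `|picard n z - l| <= E z * 2 ^- n.
  move=> z; apply: nested_limit => [n|n]; first by rewrite mulr_ge0.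
  have -> : E z * 2 ^- n - E z * 2 ^- n.+1 = 2 ^- n * expR (4 * z ^+ 2).
    rewrite /E [2 ^+ n.+1]exprS invfM; field.
    by rewrite expf_eq0 /= pnatr_eq0 andbF.
  have [z0|z0] := leP 0 z; first exact: picard_step.
  have [h1 _ _] := picard_value_like n; have [h2 _ _] := picard_value_like n.+1.
  by rewrite (h1 _ (ltW z0)) (h2 _ (ltW z0)) subrr normr0 mulr_ge0 ?expR_ge0.
have vw : value_like w.
  split.
  - move=> x x0; apply/eqP; rewrite -normr_eq0 eq_le normr_ge0 andbT.
    apply: (@le0_geometric _ (E x)) => n; have [h _ _] := picard_value_like n.
    by have := Hw x n; rewrite h// sub0r normrN.
  - move=> x y xy; rewrite -subr_le0; apply: (@le0_geometric _ (E x + E y)) => n.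
    have [_ h _] := picard_value_like n.
    have := Hw x n; have := Hw y n; have := h x y xy; rewrite !ler_norml; lra.
  - move=> x y xy; rewrite -subr_le0; apply: (@le0_geometric _ (E x + E y)) => n.
    have [_ _ h] := picard_value_like n.
    have := Hw x n; have := Hw y n; have := h x y xy; rewrite !ler_norml; lra.
exists w => // z; have [z0|z0] := leP z 0.
  by rewrite integ_empty//; case: vw => ->.
apply/eqP; rewrite -subr_eq0 -normr_eq0 eq_le normr_ge0 andbT.
(* Both sides are compared with [picard n.+1 z]: the first summand is its distance to [w z], the
   second the drift error accumulated over [0, z]. *)
apply: (@le0_geometric _ (E z + 4 * z * E z * z)) => n.
have vn := picard_value_like n.
have H1 : `|picard n.+1 z - w z| <= E z * 2 ^- n.
  rewrite (le_trans (Hw z n.+1))// ler_wpM2l//.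
  by rewrite [2 ^+ n.+1]exprS invfM ler_piMl// invf_le1 ?ler1n.
have H2 : `|integ (drift (picard n)) 0 z - integ (drift w) 0 z| <= 4 * z * E z * z * 2 ^- n.
  rewrite -integB; [|exact: drift_lbm..].
  apply: (@le_trans _ _ (4 * z * (E z * 2 ^- n) * (z - 0))); last first.
    by rewrite subr0 le_eqVlt; apply/orP; left; apply/eqP; ring.
  apply: integ_norm_le; [|exact: ltW|].
    by apply: lbmB; exact: drift_lbm.
  move=> x /andP[x0 xz]; apply: (@le_trans _ _ (4 * x * (E z * 2 ^- n))); last first.
    by rewrite ler_wpM2r ?mulr_ge0// ler_wpM2l.
  apply: drift_lip => //; first by rewrite mulr_ge0.
  move=> y /andP[y0 yx]; rewrite (le_trans (Hw y n))// ler_wpM2r//.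
  by rewrite ler_wpM2l// ler_expR ler_wpM2l// ler_sqr ?nnegrE//; lra.
rewrite mulrDl -(subrK (picard n.+1 z) (w z)) -addrA (le_trans (ler_normD _ _))//.
by rewrite lerD// distrC.
Qed.

End OptimalityEquation.

(** * Contraction of oscillations *)

Section AveragingDynamics.
Variable R : realType.
Implicit Types (f df : R -> R) (a b c k x y z : R).

(** The barrier f(c) + (C + 1)(1 - 1/x) is increasing and bounded, with slope above C x^-3. Where
    [f] meets it, [f] is at a running maximum, so the hypothesis forbids crossing. The initial
    stretch of length 2 leaves room for the window of the drift estimates. *)
Lemma bounded_above_of_max_principle f df (Z0 C : R) : 1 <= Z0 -> 0 <= C ->
  (forall z, Z0 <= z -> is_derive z (1 : R) f (df z)) ->
  (forall z, Z0 + 2 <= z -> (forall x, Z0 <= x <= z -> f x <= f z) ->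
    df z <= C * z ^- 3) ->
  exists D, forall z, Z0 <= z -> f z <= D.
Proof.
move=> Z1 C0 dF H; pose Z := Z0 + 2.
have cf z : Z0 <= z -> {for z, continuous f}.
  by move=> Zz; apply: derive_continuous (dF z Zz).
have [c _ Hc] : exists2 c, c \in `[Z0, Z] & forall t, t \in `[Z0, Z] -> f t <= f c.
  apply: EVT_max; first by rewrite /Z; lra.
  apply: continuous_in_subspaceT => x; rewrite inE /= in_itv /= => /andP[+ _].
  exact: cf.
exists (f c + (C + 1)) => z Zz.
have small : f c <= f c + (C + 1) by lra.
have [zZ|/ltW zZ] := leP z Z.
  by apply: (le_trans _ small); apply: Hc; rewrite in_itv /= Zz.
pose B x := f c + (C + 1) * (1 - x^-1).
have x0 x : Z <= x -> 0 < x by rewrite /Z; lra.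
have Bmono x y : Z <= x -> x <= y -> B x <= B y.
  move=> Zx xy; rewrite lerD2l ler_wpM2l ?addr_ge0// lerD2l lerN2 lef_pV2// posrE.
    by apply: x0; rewrite (le_trans Zx).
  exact: x0.
have Bge x : Z <= x -> f c <= B x.
  move=> Zx; have C1 : 0 <= C + 1 by lra.
  rewrite lerDl mulr_ge0// subr_ge0 invf_le1 ?x0//.
  by move: Zx; rewrite /Z; lra.
have dB x : Z <= x -> is_derive x (1 : R) (fun x => B x - f x) ((C + 1) * x ^- 2 - df x).
  move=> Zx; apply: derive_sub; last by apply: dF; move: Zx; rewrite /Z; lra.
  have := derive_add (derive_cst (f c) x) (derive_scale (C + 1)
    (derive_sub (derive_cst 1 x) (derive_inv (lt0r_neq0 (x0 _ Zx))))).
  by rewrite add0r sub0r opprK.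
have : 0 <= B z - f z.
  apply: (@barrier _ (fun x => B x - f x) Z z) => //; last by rewrite zZ lexx.
  - by move=> x /andP[Zx _]; apply: derive_continuous (dB x Zx).
  - rewrite subr_ge0 (le_trans _ (Bge _ (lexx _)))//; apply: Hc.
    by rewrite in_itv /= lexx andbT /Z; lra.
  - move=> x /andP[Zx xz] /eqP; rewrite subr_eq0 => /eqP Bx Hx.
    exists ((C + 1) * x ^- 2 - df x); last exact: dB.
    have : df x <= C * x ^- 3.
      apply: H => // y /andP[Zy yx]; rewrite -Bx; have [yZ|/ltW Zy'] := leP y Z.
        by rewrite (le_trans _ (Bge _ Zx))//; apply: Hc; rewrite in_itv /= Zy.
      apply: (le_trans _ (Bmono _ _ Zy' yx)); rewrite -subr_ge0; apply: Hx.
      by rewrite Zy'.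
    have x1 : 1 <= x by move: Zx; rewrite /Z; lra.
    have xx := x0 _ Zx.
    have : C * x ^- 3 <= C * x ^- 2.
      rewrite ler_wpM2l// lef_pV2 ?posrE ?exprn_gt0//.
      exact: ler_weXn2l.
    have : 0 < x ^- 2 by rewrite invr_gt0 exprn_gt0.
    by rewrite mulrDl mul1r; lra.
rewrite subr_ge0 => /le_trans; apply; rewrite /B lerD2l ler_piMr ?addr_ge0//.
by rewrite gerBl invr_ge0 ltW// x0.
Qed.

(** The comparison function M + 2 e t - exp(-k t)(M - f(s + A)) solves the extremal equation with
    [2 * e] in place of [e]; this makes the inequality strict, as [barrier] demands. On the windows
    met so far [f] is at most M + 2 e t, which serves as [N]. *)
Lemma one_sided_contraction f df (A k e s M : R) : 0 < A -> 0 <= k -> 0 < e ->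
  (forall z, s + A <= z -> is_derive z (1 : R) f (df z)) ->
  (forall z N, s + A <= z -> (forall x, z - A <= x <= z -> f x <= N) ->
     df z <= k * (N - f z) + e) ->
  (forall x, s <= x <= s + A -> f x <= M) ->
  forall z, s + A <= z <= s + 2 * A ->
  f z <= M + 2 * e * A - expR (- (k * A)) * (M - f (s + A)).
Proof.
move=> A0 k0 e0 dF H fM.
have Mv : 0 <= M - f (s + A) by rewrite subr_ge0 fM// lerDl ltW// lexx.
pose t z := z - (s + A).
pose B z := M + 2 * e * t z - expR (- k * t z) * (M - f (s + A)).
have dt z : is_derive z (1 : R) t 1.
  by have := derive_sub (derive_id z) (derive_cst (s + A) z); rewrite subr0.
have dB z : is_derive z (1 : R) B
    (2 * e + k * expR (- k * t z) * (M - f (s + A))).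
  have d1 := derive_scale (- k) (dt z).
  have d2 := derive_comp (f := expR) (g := fun u => - k * t u) (is_derive_expR (- k * t z)) d1.
  have d3 := derive_mul d2 (derive_cst (M - f (s + A)) z).
  have d4 := derive_sub (derive_add (derive_cst M z) (derive_scale (2 * e) (dt z))) d3.
  by apply: (is_derive_eq d4); ring.
have key z : s + A <= z <= s + 2 * A -> 0 <= B z - f z.
  apply: (@barrier _ (fun x => B x - f x)); first by lra.
  - move=> x /andP[sx _].
    exact: derive_continuous (derive_sub (dB x) (dF x sx)).
  - by rewrite /B /t subrr !mulr0 expR0; lra.
  - move=> x /andP[sx x2] /eqP; rewrite subr_eq0 => /eqP Bx Hx.
    exists (2 * e + k * expR (- k * t x) * (M - f (s + A)) - df x); last first.
      by apply: derive_sub => //; exact: dF.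
    have fN y : x - A <= y <= x -> f y <= M + 2 * e * t x.
      move=> /andP[xy yx]; have tx : 0 <= t x by rewrite /t; lra.
      have [ys|/ltW sy] := leP y (s + A).
        apply: (@le_trans _ _ M); first by apply: fM; lra.
        by rewrite lerDl !mulr_ge0// (ltW e0).
      apply: (@le_trans _ _ (B y)).
        by rewrite -subr_ge0; apply: Hx; rewrite sy.
      apply: (@le_trans _ _ (M + 2 * e * t y)).
        by rewrite gerDl oppr_le0 mulr_ge0 ?expR_ge0.
      by rewrite lerD2l ler_wpM2l ?mulr_ge0 ?(ltW e0)// /t; lra.
    have := H x _ sx fN; rewrite -Bx /B.
    have -> : M + 2 * e * t x - (M + 2 * e * t x - expR (- k * t x) * (M - f (s + A)))
      = expR (- k * t x) * (M - f (s + A)) by ring.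
    rewrite mulrA; lra.
move=> z zs; have := key z zs; rewrite subr_ge0 => /le_trans; apply.
rewrite /B lerB//.
  by rewrite lerD2l ler_wpM2l ?mulr_ge0 ?(ltW e0)// /t; lra.
rewrite ler_wpM2r// ler_expR mulNr lerN2 ler_wpM2l// /t; lra.
Qed.

(** Moving one window ahead, the gain 1 - r/2 must absorb the growth of p^3. With q = A/p one has (1
    + q)^3 <= 1 + 7 q, and 14 q <= r bounds this by 1 + r/2. *)
Lemma contraction_factor (A p r : R) : 1 <= A -> 0 < p -> 0 < r <= 1 -> 14 * A <= p * r ->
  (1 - r / 2) * (p + A) ^+ 3 <= p ^+ 3.
Proof.
move=> A1 p0 /andP[r0 r1] pr; pose q := A / p.
have q0 : 0 <= q by rewrite divr_ge0// ?(ltW p0)//; lra.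
have AE : A = q * p by rewrite /q divfK// gt_eqF.
have q14 : 14 * q <= r by rewrite mulrA ler_pdivrMr// mulrC [r * p]mulrC; lra.
have -> : p + A = p * (1 + q) by rewrite {1}AE; ring.
clearbody q; rewrite exprMn mulrCA ler_piMr ?exprn_ge0 ?(ltW p0)//.
have q1 : 0 <= 1 - q by lra.
have q4 : 0 <= 4 + q by lra.
have := mulr_ge0 (mulr_ge0 q0 q1) q4.
have -> : q * (1 - q) * (4 + q) = 1 + 7 * q - (1 + q) ^+ 3 by ring.
move=> h; apply: (@le_trans _ _ ((1 - r / 2) * (1 + r / 2))).
  by rewrite ler_wpM2l//; lra.
have : 0 <= r * r by rewrite mulr_ge0 ?(ltW r0).
lra.
Qed.

Lemma oscillation_decay f df (A k C S D : R) : 1 <= A -> 0 <= k -> 0 < C -> 1 <= S ->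
  (forall z, S <= z -> is_derive z (1 : R) f (df z)) ->
  (forall z N, S + A <= z -> (forall x, z - A <= x <= z -> f x <= N) ->
     df z <= k * (N - f z) + C * z ^- 3) ->
  (forall z N, S + A <= z -> (forall x, z - A <= x <= z -> N <= f x) ->
     - (k * (f z - N) + C * z ^- 3) <= df z) ->
  (forall z, S <= z -> `|f z| <= D) ->
  exists K S', S <= S' /\ forall s, S' <= s -> exists m M,
    (forall x, s <= x <= s + A -> m <= f x <= M) /\ M - m <= K * s ^- 3.
Proof.
move=> A1 k0 C0 S1 dF HU HL fD.
pose r := expR (- (k * A)).
have r0 : 0 < r by exact: expR_gt0.
have r1 : r <= 1 by rewrite -expR0 ler_expR oppr_le0 mulr_ge0//; lra.
(* Beyond [S'] the condition [14 * A <= p * r] of [contraction_factor] holds. *)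
pose S' := S + 14 * A / r.
have S'S : S <= S' by rewrite lerDl divr_ge0 ?mulr_ge0 ?ltW//; lra.
(* The first entry covers the initial window, where the oscillation is at most [2 * D]; the second
   makes the error [4 * e * A] at most half of what the contraction gains. *)
pose K := Num.max (2 * D * (S' + A) ^+ 3) (8 * C * A / r).
have K1 : 2 * D * (S' + A) ^+ 3 <= K by rewrite le_max lexx.
have K2 : 8 * C * A <= K * r by rewrite -ler_pdivrMr// le_max lexx orbT.
have K0 : 0 <= K by rewrite le_max orbC divr_ge0 ?(ltW r0)// !mulr_ge0 ?(ltW C0)//; lra.
exists K, S'; split=> //.
suff H n s : S' <= s <= S' + n.+1%:R * A -> exists m M,
    (forall x, s <= x <= s + A -> m <= f x <= M) /\ M - m <= K * s ^- 3.
  move=> s Ss; have [n Hn] : exists n, (s - S') / A < n%:R.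
    by exists (Num.truncn ((s - S') / A)).+1; exact: truncnS_gt.
  apply: (H n); rewrite Ss /=; move: Hn; rewrite ltr_pdivrMr; last by lra.
  have : n%:R * A <= n.+1%:R * A by rewrite ler_wpM2r ?ler_nat//; lra.
  lra.
elim: n s => [|n IH] s /andP[Ss sn].
  exists (- D), D; split=> [x /andP[sx _]|].
    by rewrite -ler_norml fD//; lra.
  have s0 : 0 < s by lra.
  rewrite ler_pdivlMr ?exprn_gt0//; apply: le_trans K1.
  have D0 : 0 <= D by rewrite (le_trans _ (fD S (lexx _))).
  have -> : D - - D = 2 * D by ring.
  rewrite ler_wpM2l ?mulr_ge0// lerXn2r ?nnegrE//; move: sn; rewrite ?mul1r; lra.
have [sS|/ltW Ss'] := leP s (S' + n.+1%:R * A); first by apply: IH; rewrite Ss.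
have nA : A <= n.+1%:R * A by rewrite ler_peMl ?ler1n//; lra.
pose p := s - A.
have Sp : S' <= p by rewrite /p; lra.
have [m [M [fmM Mm]]] : exists m M,
    (forall x, p <= x <= p + A -> m <= f x <= M) /\ M - m <= K * p ^- 3.
  by apply: IH; rewrite Sp /p; move: sn; rewrite -[n.+2%:R]natr1 mulrDl mul1r; lra.
have p0 : 0 < p by lra.
pose e := C * p ^- 3.
have e0 : 0 < e by rewrite mulr_gt0// invr_gt0 exprn_gt0.
have ez z : p + A <= z -> C * z ^- 3 <= e.
  move=> pz; rewrite (ler_wpM2l (ltW C0))// lef_pV2 ?posrE ?exprn_gt0//; last by lra.
  by rewrite lerXn2r ?nnegrE; lra.
have U := @one_sided_contraction f df A k e p M _ k0 e0 _ _ _.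
have V := @one_sided_contraction (fun x => - f x) (fun x => - df x) A k e p (- m) _ k0 e0 _ _ _.
exists (m - 2 * e * A + r * (f s - m)), (M + 2 * e * A - r * (M - f s)).
have sE : s = p + A by rewrite /p; ring.
split.
  move=> x; rewrite sE => xs.
  have xs' : p + A <= x <= p + 2 * A by lra.
  apply/andP; split.
    have := V; rewrite -/r => /(_ _ _ _ _ x xs') V'.
    have : - f x <= - m + 2 * e * A - r * (- m - - f (p + A)).
      apply: V'; first by lra.
      - by move=> z zp; apply: derive_opp; apply: dF; lra.
      - move=> z N zp HN; have zS : S + A <= z by lra.
        have := HL z (- N) zS; have HN' y : z - A <= y <= z -> - N <= f y.
          by move=> /HN; lra.
        by move=> /(_ HN'); have := ez z zp; rewrite opprK; lra.
      - by move=> y /fmM; lra.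
    by rewrite opprK; lra.
  apply: U => //; first by lra.
  - by move=> z zp; apply: dF; lra.
  - move=> z N zp HN; have zS : S + A <= z by lra.
    by have := HU z N zS HN; have := ez z zp; lra.
  - by move=> y /fmM /andP[].
(* Both one-sided corrections refer to the same value [f s] at the common end point, so they add up
   to [r * (M - m)] wherever [f s] lies. *)
have -> : M + 2 * e * A - r * (M - f s) - (m - 2 * e * A + r * (f s - m)) =
  (1 - r) * (M - m) + 4 * e * A by ring.
apply: (@le_trans _ _ (K * (1 - r / 2) * p ^- 3)).
  have h1 : (1 - r) * (M - m) <= (1 - r) * (K * p ^- 3) by rewrite ler_wpM2l//; lra.
  have h2 : 4 * e * A <= K * r / 2 * p ^- 3.
    have -> : 4 * e * A = 4 * C * A * p ^- 3 by rewrite /e; ring.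
    by rewrite ler_wpM2r ?invr_ge0 ?exprn_ge0 ?(ltW p0)//; lra.
  have -> : K * (1 - r / 2) * p ^- 3 = (1 - r) * (K * p ^- 3) + K * r / 2 * p ^- 3 by field; lra.
  lra.
rewrite -mulrA ler_wpM2l// ler_pdivrMr ?exprn_gt0// [_^-1 * _]mulrC ler_pdivlMr; last first.
  by rewrite exprn_gt0//; lra.
rewrite sE; apply: contraction_factor => //; first by rewrite r0.
by rewrite -ler_pdivrMr//; move: Sp; rewrite /S'; lra.
Qed.

(** Since K z^-3 integrates to (K/2) z^-2, the function f - (K/2) z^-2 is nondecreasing and f +
    (K/2) z^-2 nonincreasing; the limit separates them. *)
Lemma convergence_of_cubic_derivative f df (S K : R) : 1 <= S -> 0 <= K ->
  (forall z, S <= z -> is_derive z (1 : R) f (df z)) ->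
  (forall z, S <= z -> `|df z| <= K * z ^- 3) ->
  exists c, forall z, S <= z -> `|f z - c| <= K * z ^- 2.
Proof.
move=> S1 K0 dF Hdf.
have z0 z : S <= z -> 0 < z by lra.
have dI z : S <= z -> is_derive z (1 : R) (fun t => K / 2 * (t ^+ 2)^-1) (- (K * z ^- 3)).
  move=> Sz; have zn : z != 0 by rewrite gt_eqF ?z0.
  have zn2 : z ^+ 2 != 0 by rewrite expf_eq0 negb_and zn orbT.
  have := derive_scale (K / 2) (derive_comp (f := GRing.inv)
    (g := fun t => t ^+ 2) (derive_inv zn2) (derive_exp 2 z)).
  move=> H; apply: (is_derive_eq H); rewrite /= expr1; field.
  exact: zn.
have lo x y : S <= x -> x <= y -> f x - K / 2 * x ^- 2 <= f y - K / 2 * y ^- 2.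
  move=> Sx xy.
  apply: (@derive_mono_cc _ (fun t => f t - K / 2 * (t ^+ 2)^-1)
    (fun t => df t - - (K * t ^- 3)) _ _ xy).
    move=> t /andP[xt _]; have St := le_trans Sx xt.
    by apply: derive_sub; [exact: dF|exact: dI].
  by move=> t /andP[xt _]; have := Hdf t (le_trans Sx xt); rewrite ler_norml; lra.
have hi x y : S <= x -> x <= y -> f y + K / 2 * y ^- 2 <= f x + K / 2 * x ^- 2.
  move=> Sx xy; rewrite -lerN2.
  apply: (@derive_mono_cc _ (fun t => - (f t + K / 2 * (t ^+ 2)^-1))
    (fun t => - (df t + - (K * t ^- 3))) _ _ xy).
    move=> t /andP[xt _]; have St := le_trans Sx xt.
    by apply: derive_opp; apply: derive_add; [exact: dF|exact: dI].
  by move=> t /andP[xt _]; have := Hdf t (le_trans Sx xt); rewrite ler_norml; lra.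
pose e z := K / 2 * z ^- 2.
have e0 z : S <= z -> 0 <= e z.
  by move=> Sz; rewrite mulr_ge0 ?divr_ge0// invr_ge0 exprn_ge0// ltW// z0.
pose X := [set f z - e z | z in [set z | S <= z]].
have cross x y : S <= x -> S <= y -> f x - e x <= f y + e y.
  move=> Sx Sy; have [xy|/ltW yx] := leP x y.
    by apply: (le_trans (lo _ _ Sx xy)); have := e0 y Sy; rewrite -/(e y); lra.
  by apply: (le_trans _ (hi _ _ Sy yx)); have := e0 x Sx; rewrite -/(e x); lra.
have X0 : X !=set0 by exists (f S - e S), S => //=.
exists (sup X) => z Sz.
have eK : e z <= K * z ^- 2.
  rewrite ler_wpM2r ?invr_ge0 ?exprn_ge0 ?(ltW (z0 _ Sz))//; lra.
apply: le_trans eK; rewrite ler_distlC; apply/andP; split.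
  by apply: ub_le_sup; [exists (f S + e S) => _ [x /= Sx <-]; exact: cross|exists z].
by apply: ge_sup => // _ [x /= Sx <-]; exact: cross.
Qed.

End AveragingDynamics.

(** * The asymptotic expansion *)

Section AsymptoticExpansion.
Variable R : realType.
Implicit Types (w : R -> R) (c h k s x y z A L M T : R).
Local Notation a := (Num.sqrt (2 : R)).

Lemma sqrt2_sqr : a ^+ 2 = 2.
Proof. by rewrite sqr_sqrtr. Qed.

Lemma sqrt2_bounds : 7 / 5 <= a <= 71 / 50.
Proof.
have a0 : 0 <= a by exact: sqrtr_ge0.
have := sqrt2_sqr; rewrite expr2 => a2; apply/andP; split; rewrite leNgt; apply/negP => h.
  have : a * a < 7 / 5 * (7 / 5) by apply: ltr_pM.
  by rewrite a2; lra.
have : 71 / 50 * (71 / 50) < a * a by apply: ltr_pM; lra.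
by rewrite a2; lra.
Qed.

(** The coefficients -1/6 and a/144 make the optimal profit agree with [slope] up to and including
    the order z^-2, see [profit_expansion] at s = 0. *)
Definition expansion z : R := a * z - 6^-1 * ln z + a / (144 * z).
Definition slope z : R := a - z^-1 / 6 - a * z ^- 2 / 144.
(** Half the leading term of the second derivative of [expansion]; the remainder of that derivative
    is of order z^-3. *)
Definition curvature z : R := z ^- 2 / 12.

Lemma expansion_is_derive z : 0 < z ->
  is_derive z (1 : R) expansion (slope z).
Proof.
move=> z0; have zn := lt0r_neq0 z0.
have -> : expansion = fun t => a * t - 6^-1 * ln t + a / 144 * t^-1.
  by apply/funext => t; rewrite /expansion invfM mulrA.
apply: (is_derive_eq (derive_add (derive_sub (derive_scale a (derive_id z))
  (derive_scale 6^-1 (is_derive1_ln z0))) (derive_scale (a / 144) (derive_inv zn)))).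
by rewrite /slope; ring.
Qed.

Lemma expansion_growth x z : 1 <= x <= z -> z - x <= expansion z - expansion x.
Proof.
move=> /andP[x1 xz].
suff : expansion x - x <= expansion z - z by lra.
have /= := @derive_mono_cc _ (fun t => expansion t - t)
  (fun t => slope t - 1) x z xz; apply.
  move=> t /andP[xt _]; have t0 : 0 < t by lra.
  exact: (derive_sub (expansion_is_derive t0) (derive_id t)).
move=> t /andP[xt _]; rewrite /slope.
have t1 : t^-1 <= 1 by rewrite invf_le1; lra.
have t2 : t ^- 2 <= 1 by rewrite invf_le1 ?exprn_gt0 ?exprn_ege1//; lra.
have /andP[a1 a2] := sqrt2_bounds.
have : a * t ^- 2 <= a by rewrite ler_piMr//; lra.
lra.
Qed.

(** Derivatives are compared through 1/(1 - t) = 1 + t + t^2/(1 - t), whose last term lies between 0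
    and 2 t^2. *)
Lemma ln_expansion x : 0 <= x <= 2^-1 ->
  - x - x ^+ 2 / 2 - x ^+ 3 <= ln (1 - x) <= - x - x ^+ 2 / 2.
Proof.
move=> /andP[x0 x2].
have dl t : 0 <= t <= x -> is_derive t (1 : R) (fun t => ln (1 - t)) (- (1 - t)^-1).
  move=> /andP[t0 tx]; have t1 : 0 < 1 - t by lra.
  have := derive_comp (f := @ln R) (g := fun t => 1 - t) (is_derive1_ln t1)
    (derive_sub (derive_cst 1 t) (derive_id t)).
  by rewrite sub0r mulrN1.
have i1 t : 0 <= t <= x -> 1 <= (1 - t)^-1 <= 2.
  move=> /andP[t0 tx]; have t1 : 0 < 1 - t by lra.
  by apply/andP; split; [rewrite -[leLHS]invr1|rewrite -[leRHS]invrK];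
    rewrite lef_pV2 ?posrE ?invr_gt0//; lra.
have i2 t : 0 <= t <= x -> (1 - t)^-1 = 1 + t + t ^+ 2 * (1 - t)^-1.
  by move=> /andP[t0 tx]; field; lra.
apply/andP; split.
  pose F t : R := ln (1 - t) - (- 1 * t - 2^-1 * t ^+ 2 - t ^+ 3).
  have := @derive_mono_cc _ F
    (fun t => - (1 - t)^-1 - (- 1 * 1 - 2^-1 * (2 * t ^+ 1) - 3 * t ^+ 2)) 0 x x0.
  rewrite /F subr0 ln1 !expr0n /= !mulr0 !subr0.
  move=> H; suff : 0 <= ln (1 - x) - (- 1 * x - 2^-1 * x ^+ 2 - x ^+ 3) by lra.
  apply: H => t tx.
    exact: (derive_sub (dl t tx) (derive_sub (derive_sub (derive_scale (-1) (derive_id t))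
      (derive_scale 2^-1 (derive_exp 2 t))) (derive_exp 3 t))).
  rewrite (i2 t tx); have /andP[j1 j2] := i1 t tx.
  have : t ^+ 2 * (1 - t)^-1 <= t ^+ 2 * 2 by rewrite ler_wpM2l ?sqr_ge0.
  have := sqr_ge0 t; rewrite expr1; lra.
pose F t : R := - 1 * t - 2^-1 * t ^+ 2 - ln (1 - t).
have := @derive_mono_cc _ F (fun t => - 1 * 1 - 2^-1 * (2 * t ^+ 1) - - (1 - t)^-1) 0 x x0.
rewrite /F subr0 ln1 !expr0n /= !mulr0 !subr0.
move=> H; suff : 0 <= - 1 * x - 2^-1 * x ^+ 2 - ln (1 - x) by lra.
apply: H => t tx.
  exact: (derive_sub (derive_sub (derive_scale (-1) (derive_id t))
    (derive_scale 2^-1 (derive_exp 2 t))) (dl t tx)).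
rewrite (i2 t tx); have /andP[j1 j2] := i1 t tx.
have : 0 <= t ^+ 2 * (1 - t)^-1 by rewrite mulr_ge0 ?sqr_ge0//; lra.
rewrite expr1; lra.
Qed.

(** With y = x z exactly two errors remain: the remainder of ln(1 - x), and x^2/(1 - x) times a
    multiple of 1/z. Both are cubic in 1/z because x <= L/z. *)
Lemma expansion_increment L y z : 1 <= L -> 0 <= y <= L -> 2 * L <= z ->
  `|expansion z - expansion (z - y) - (slope z * y - curvature z * y ^+ 2)|
    <= L ^+ 3 * z ^- 3.
Proof.
move=> L1 /andP[y0 yL] zL; have z0 : 0 < z by lra.
pose x := y / z.
have yE : y = x * z by rewrite /x divfK// gt_eqF.
have x0 : 0 <= x by rewrite divr_ge0// ltW.
have x2 : x <= 2^-1 by rewrite ler_pdivrMr//; lra.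
have x1 : 0 < 1 - x by lra.
have xL : x <= L * z^-1 by rewrite ler_wpM2r// invr_ge0 ltW.
have -> : z - y = z * (1 - x) by rewrite yE; ring.
have -> : expansion z - expansion (z * (1 - x)) - (slope z * y - curvature z * y ^+ 2) =
    6^-1 * (ln (1 - x) - (- x - x ^+ 2 / 2)) - a / 144 * z^-1 * (x ^+ 2 * (1 - x)^-1).
  rewrite /expansion lnM ?posrE// /slope /curvature yE; field.
  by rewrite !gt_eqF.
have /andP[l1 l2] := ln_expansion (introT andP (conj x0 x2)).
have h0 : 0 < z^-1 by rewrite invr_gt0.
have /andP[a1 a2] := sqrt2_bounds.
have i2 : (1 - x)^-1 <= 2 by rewrite -[leRHS]invrK lef_pV2 ?posrE ?invr_gt0//; lra.
have i0 : 0 <= (1 - x)^-1 by rewrite invr_ge0 ltW.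
have x3 : x ^+ 3 <= L ^+ 3 * z ^- 3.
  by rewrite -exprVn -exprMn lerXn2r ?nnegrE ?mulr_ge0 ?(ltW h0)//; lra.
have xx : z^-1 * (x ^+ 2 * (1 - x)^-1) <= 2 * (L ^+ 3 * z ^- 3).
  have -> : 2 * (L ^+ 3 * z ^- 3) = z^-1 * ((L * z^-1) ^+ 2 * 2) * L.
    by rewrite -exprVn; ring.
  apply: (@le_trans _ _ (z^-1 * ((L * z^-1) ^+ 2 * 2))).
    rewrite ler_wpM2l ?(ltW h0)// ler_pM ?sqr_ge0// lerXn2r ?nnegrE ?mulr_ge0 ?(ltW h0)//; lra.
  have p0 : 0 <= (L * z^-1) ^+ 2 * 2 by rewrite mulr_ge0 ?sqr_ge0.
  by rewrite ler_peMr// mulr_ge0// ltW.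
have xx0 : 0 <= z^-1 * (x ^+ 2 * (1 - x)^-1) by rewrite !mulr_ge0 ?(ltW h0) ?sqr_ge0.
have aa : a / 144 * (z^-1 * (x ^+ 2 * (1 - x)^-1)) <= 1 / 72 * (2 * (L ^+ 3 * z ^- 3)).
  by rewrite ler_pM ?divr_ge0//; lra.
have aa0 : 0 <= a / 144 * (z^-1 * (x ^+ 2 * (1 - x)^-1)) by rewrite mulr_ge0 ?divr_ge0//; lra.
have x30 : 0 <= x ^+ 3 by rewrite exprn_ge0.
rewrite -[a / 144 * _ * _]mulrA ler_norml; lra.
Qed.

Lemma integ_polynomial_reward z T c p q : 0 <= T ->
  integ (fun x => x * (c - p * (z - x) + q * (z - x) ^+ 2)) (z - T) z =
  c * z * T - (c + p * z) * T ^+ 2 / 2 + (p + q * z) * T ^+ 3 / 3 - q * T ^+ 4 / 4.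
Proof.
move=> T0.
pose F x : R := - (c * z * (z - x) + (- (c + p * z) / 2) * (z - x) ^+ 2 +
  ((p + q * z) / 3) * (z - x) ^+ 3 + (- q / 4) * (z - x) ^+ 4).
have dzx x : is_derive x (1 : R) (fun x => z - x) (-1).
  by have := derive_sub (derive_cst z x) (derive_id x); rewrite sub0r.
have dp n x := derive_comp (f := fun t => t ^+ n) (g := fun x => z - x)
  (derive_exp n (z - x)) (dzx x).
have dF x : is_derive x (1 : R) F (x * (c - p * (z - x) + q * (z - x) ^+ 2)).
  have := derive_opp (derive_add (derive_add (derive_add (derive_scale (c * z) (dzx x))
    (derive_scale (- (c + p * z) / 2) (dp 2%N x))) (derive_scale ((p + q * z) / 3) (dp 3%N x)))
    (derive_scale (- q / 4) (dp 4%N x))).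
  move=> H; apply: (is_derive_eq H); by rewrite /=; field.
have cf : continuous (fun x => x * (c - p * (z - x) + q * (z - x) ^+ 2)).
  move=> x; have := derive_mul (derive_id x) (derive_add (derive_sub (derive_cst c x)
    (derive_scale p (dzx x))) (derive_scale q (dp 2%N x))).
  exact: derive_continuous.
have zT : z - T <= z by lra.
by rewrite (integ_FTC2 zT cf (fun x _ => dF x)) /F; field.
Qed.

(** This and the next two lemmas compute a bound for a polynomial from bounds on its variables. *)
Lemma bounded_add x y A M : `|x| <= A -> `|y| <= M -> `|x + y| <= A + M.
Proof. by move=> xA yM; rewrite (le_trans (ler_normD _ _))// lerD. Qed.

Lemma bounded_mul x y A M : `|x| <= A -> `|y| <= M -> `|x * y| <= A * M.
Proof. by move=> xA yM; rewrite normrM ler_pM. Qed.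

Lemma bounded_exp x A n : `|x| <= A -> `|x ^+ n| <= A ^+ n.
Proof. by move=> xA; rewrite normrX lerXn2r ?nnegrE// (le_trans _ xA). Qed.

(* The profit of waiting for jumps of size at most [T] is a quadratic function of the
   deviation [s] of [T] from the optimum, up to cubic errors in [h = 1 / z]. *)
Lemma profit_expansion : exists2 K : R, 0 <= K &
  forall h s p q T, 0 <= h <= 1 / 20 -> `|s| <= 2 ->
  p = a - h / 6 - a * h ^+ 2 / 144 -> q = h ^+ 2 / 12 -> T = a / 2 + h / 12 + s ->
  `|4 * (T - (h + p) * T ^+ 2 / 2 + (p * h + q) * T ^+ 3 / 3 - q * h * T ^+ 4 / 4)
    - (p - s ^+ 2 * (2 * a - 7 / 3 * h - 13 / 72 * a * h ^+ 2 - 4 / 3 * a * h * s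
                    + h ^+ 2 * s / 9) + h ^+ 2 * s / 4)| <= K * h ^+ 3.
Proof.
(* Up to sign, the exact quotient of the remainder by h^3, with powers of [a] reduced by a^2 = 2. *)
pose E h s : R := 1 / 48 + 29 / (48 * 72) * a * h + 31 / (216 * 72) * h ^+ 2 +
  19 / (432 * 432) * a * h ^+ 3 + 1 / (12 * 144 * 144) * h ^+ 4 +
  s * (41 / 432 * a + 7 / 144 * h + 19 / (72 * 72) * a * h ^+ 2 + 1 / (72 * 72) * h ^+ 3) +
  s ^+ 2 * (11 / 36 + 19 / 432 * a * h + 1 / 288 * h ^+ 2) +
  s ^+ 3 * (19 / 108 * a + 1 / 36 * h) + s ^+ 4 * (1 / 12).
have [K HK] : exists K, forall h s, `|h| <= 1 -> `|s| <= 2 -> `|E h s| <= K.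
  (* The bound is an existential variable created before [h] and [s]; walking through the polynomial
     instantiates it by a constant. *)
  eexists=> h s h1 s2; rewrite /E.
  repeat lazymatch goal with
    | |- is_true (`|_ + _| <= _) => eapply bounded_add
    | |- is_true (`|_ * _| <= _) => eapply bounded_mul
    | |- is_true (`|_ ^+ _| <= _) => eapply bounded_exp
    | |- is_true (`|h| <= _) => exact: h1
    | |- is_true (`|s| <= _) => exact: s2
    | _ => exact: lexx
    end.
exists K; first by apply: (le_trans (normr_ge0 _) (HK 0 0 _ _)); rewrite normr0.
move=> h s p q T /andP[h0 h1] s2 pE qE TE.
have hh : `|h| <= 1 by rewrite ger0_norm//; lra.
have -> : 4 * (T - (h + p) * T ^+ 2 / 2 + (p * h + q) * T ^+ 3 / 3 - q * h * T ^+ 4 / 4)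
    - (p - s ^+ 2 * (2 * a - 7 / 3 * h - 13 / 72 * a * h ^+ 2 - 4 / 3 * a * h * s
                    + h ^+ 2 * s / 9) + h ^+ 2 * s / 4) = - (E h s * h ^+ 3).
  by rewrite TE pE qE /E; field: sqrt2_sqr.
rewrite normrN normrM (ger0_norm (exprn_ge0 _ h0)) ler_wpM2r ?exprn_ge0//.
exact: HK.
Qed.

End AsymptoticExpansion.

(** * Maximal profit over the jump threshold *)

Section ProfitBounds.
Variable R : realType.
Implicit Types (c h k p q s x y z A L M T : R).
Local Notation a := (Num.sqrt (2 : R)).

Lemma slope_bounds z : 20 <= z -> 27 / 20 <= slope z <= 71 / 50.
Proof.
move=> z20; have /andP[a1 a2] := sqrt2_bounds R.
have h0 : 0 < z^-1 by rewrite invr_gt0; lra.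
have h1 : z^-1 <= 1 / 20 by rewrite -[leRHS]invrK lef_pV2 ?posrE//; lra.
have h2 : z ^- 2 <= 1 / 20 * (1 / 20).
  by rewrite -exprVn expr2; apply: ler_pM; lra.
have h20 : 0 <= z ^- 2 by rewrite -exprVn sqr_ge0.
have : a * z ^- 2 <= 71 / 50 * (1 / 20 * (1 / 20)) by apply: ler_pM; lra.
have : 0 <= a * z ^- 2 by rewrite mulr_ge0//; lra.
rewrite /slope; lra.
Qed.

(** The closed form from [integ_polynomial_reward] for p = slope z and q = curvature z: the
    approximate reward collected from jumps of size at most [T]. *)
Definition profit c z T : R := c * z * T - (c + slope z * z) * T ^+ 2 / 2
  + (slope z + curvature z * z) * T ^+ 3 / 3 - curvature z * T ^+ 4 / 4.

(** The shifts by 8 z^-3 absorb the error of [expansion_increment] with L = 2. The upper bound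
    covers every [T], hence the true threshold; for the lower bound one good [T] is enough. *)
Lemma profit_bounds : exists2 K : R, 0 <= K & forall z, 20 <= z ->
  (forall T, 0 <= T <= 2 ->
    4 / z * profit (1 + 8 * z ^- 3) z T <= slope z + K * z ^- 3) /\
  slope z - K * z ^- 3 <=
    4 / z * profit (1 - 8 * z ^- 3) z (a / 2 + z^-1 / 12).
Proof.
(* Of the 65, the shift of the constant costs 4 * 8 * 2 = 64 and completing the square costs 1. *)
have [K K0 HK] := profit_expansion R; exists (K + 65); first by lra.
move=> z z20; have z0 : 0 < z by lra.
pose h := z^-1.
have h0 : 0 < h by rewrite invr_gt0.
have h1 : h <= 1 / 20 by rewrite /h -[leRHS]invrK lef_pV2 ?posrE//; lra.
have hh : 0 <= h <= 1 / 20 by rewrite h1 ltW.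
have h3E : z ^- 3 = h ^+ 3 by rewrite exprVn.
have h30 : 0 <= h ^+ 3 by rewrite exprn_ge0// ltW.
have pE : slope z = a - h / 6 - a * h ^+ 2 / 144 by rewrite /slope -exprVn.
have qE : curvature z = h ^+ 2 / 12 by rewrite /curvature -exprVn.
have hz : h * z = 1 by rewrite mulVf// gt_eqF.
have /andP[a1 a2] := sqrt2_bounds R.
have PE e T : 4 / z * profit (1 + e) z T =
    4 * (T - (h + slope z) * T ^+ 2 / 2 + (slope z * h + curvature z) * T ^+ 3 / 3
      - curvature z * h * T ^+ 4 / 4) + 4 * e * (T - h * T ^+ 2 / 2).
  by rewrite /profit -/h; field: hz.
have ah2 : 0 <= a * h ^+ 2 <= 71 / 50 * (1 / 20 * (1 / 20)).
  have -> : a * h ^+ 2 = a * (h * h) by rewrite expr2.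
  have hh0 : 0 <= h * h by rewrite mulr_ge0 ?(ltW h0).
  rewrite (mulr_ge0 (sqrtr_ge0 _) hh0) /=.
  by apply: ler_pM => //; apply: ler_pM; rewrite ?(ltW h0).
have nh : `|h| <= 1 / 20 by rewrite ger0_norm// ltW.
have na : `|a| <= 71 / 50 by rewrite ger0_norm//; lra.
have b2 s : `|s| <= 2 -> `|a * h * s| <= 71 / 50 * (1 / 20) * 2.
  by move=> s2; do 2 apply: bounded_mul => //.
have b3 s : `|s| <= 2 -> `|h ^+ 2 * s| <= (1 / 20) ^+ 2 * 2.
  by move=> s2; apply: bounded_mul => //; exact: bounded_exp.
have h43 : h ^+ 2 * h ^+ 2 <= h ^+ 3.
  rewrite [h ^+ 3]exprS ler_wpM2r ?sqr_ge0// expr2 ler_piMr ?(ltW h0)//.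
  by rewrite (le_trans h1)//; lra.
have extra T : 0 <= T <= 2 -> 0 <= T - h * T ^+ 2 / 2 <= 2.
  move=> /andP[T0 T2]; have -> : T - h * T ^+ 2 / 2 = T * (1 - h * T / 2) by field.
  have hT0 : 0 <= h * T by rewrite mulr_ge0// ltW.
  have hT : h * T <= 1 / 20 * 2 by rewrite ler_pM// ltW.
  apply/andP; split; first by rewrite mulr_ge0//; lra.
  by rewrite (le_trans _ T2)// ler_piMr//; lra.
have c32 : 0 <= 4 * (8 * h ^+ 3) by lra.
rewrite h3E; split=> [T T02|].
  have /andP[T0 T2] := T02.
  pose s := T - a / 2 - h / 12.
  have s2 : `|s| <= 2 by rewrite ler_norml /s; lra.
  have TE : T = a / 2 + h / 12 + s by rewrite /s; ring.
  have := HK h s _ _ T hh s2 pE qE TE; rewrite ler_norml => /andP[_].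
  rewrite PE.
  set X := 4 * (T - _ + _ - _).
  set m := 2 * a - _ - _ - _ + _.
  have m1 : 1 <= m.
    by move: (b2 s s2) (b3 s s2); rewrite !ler_norml /m -!mulrA; lra.
  clearbody X m.
  have sm : s ^+ 2 <= s ^+ 2 * m by rewrite ler_peMr ?sqr_ge0.
  (* The centre a/2 + h/12 is optimal only up to O(h^2), which leaves this linear term; the
     quadratic loss, with coefficient [m >= 1], absorbs it up to h^3. *)
  have sq : h ^+ 2 * s / 4 <= s ^+ 2 + h ^+ 3.
    have := sqr_ge0 (s - h ^+ 2 / 8).
    have -> : (s - h ^+ 2 / 8) ^+ 2 = s ^+ 2 - h ^+ 2 * s / 4 + h ^+ 2 * h ^+ 2 / 64 by field.
    lra.
  have ex : 4 * (8 * h ^+ 3) * (T - h * T ^+ 2 / 2) <= 4 * (8 * h ^+ 3) * 2.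
    exact: ler_wpM2l c32 _ _ (andP (extra T T02)).2.
  lra.
have s2 : `|(0 : R)| <= 2 by rewrite normr0.
have TE : a / 2 + h / 12 = a / 2 + h / 12 + 0 by rewrite addr0.
have := HK h 0 _ _ _ hh s2 pE qE TE; rewrite ler_norml => /andP[+ _].
rewrite PE expr0n /= mul0r mulr0 mul0r subr0 addr0.
set X := 4 * (_ - _ + _ - _).
clearbody X.
have T02 : 0 <= a / 2 + h / 12 <= 2 by lra.
have ex : 4 * (8 * h ^+ 3) * (a / 2 + h / 12 - h * (a / 2 + h / 12) ^+ 2 / 2) <=
    4 * (8 * h ^+ 3) * 2.
  exact: ler_wpM2l c32 _ _ (andP (extra _ T02)).2.
rewrite -/h; lra.
Qed.

End ProfitBounds.

(** * Two-sided estimates of the drift in terms of the deviation from the expansion *)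

Section DriftBounds.
Variable R : realType.
Implicit Types (c h k p q s x y z A L M T : R).
Local Notation a := (Num.sqrt (2 : R)).

(** For c = 1 the second order approximation of [expansion x + 1 - expansion z]. *)
Definition profit_density c z x : R := c - slope z * (z - x) + curvature z * (z - x) ^+ 2.

Lemma profit_density_continuous c z : continuous (profit_density c z).
Proof.
move=> x; have dzx : is_derive x (1 : R) (fun x => z - x) (-1).
  by have := derive_sub (derive_cst z x) (derive_id x); rewrite sub0r.
have dp := derive_comp (f := fun t => t ^+ 2) (g := fun x => z - x) (derive_exp 2 (z - x)) dzx.
exact: (derive_continuous (derive_add (derive_sub (derive_cst c x)
  (derive_scale (slope z) dzx)) (derive_scale (curvature z) dp))).
Qed.

Lemma positive_profit_lbm c z :
  locally_bounded_measurable (fun x => x * Num.max (profit_density c z x) 0).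
Proof.
apply: lbm_continuous => x; apply: cvgM; first exact: cvg_id.
by apply: continuous_pos; exact: profit_density_continuous.
Qed.

(** The density has a zero at distance [T] in [0, 2] below [z], and its other zero lies outside the
    range considered. Its positive part thus lives on [z - T, z], where the integral is [profit] at
    [T]. *)
Lemma positive_profit_integral : exists2 K : R, 0 <= K & forall z A,
  20 <= z -> 2 <= A <= z ->
  4 / z * integ (fun x => x * Num.max (profit_density (1 + 8 * z ^- 3) z x) 0)
    (z - A) z <= slope z + K * z ^- 3.
Proof.
have [K K0 HK] := profit_bounds R; exists K => // z A z20 /andP[A2 Az].
have [+ _] := HK z z20 => HT.
have z0 : 0 < z by lra.
have /andP[s1 s2] := slope_bounds z20.
have h0 : 0 < z^-1 by rewrite invr_gt0.
have h1 : z^-1 <= 1 / 20 by rewrite -[leRHS]invrK lef_pV2 ?posrE//; lra.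
have h3 : 0 <= z ^- 3 <= 1 / 20 * (1 / 20 * (1 / 20)).
  rewrite -exprVn exprn_ge0 ?(ltW h0)//= exprS expr2.
  by apply: ler_pM; rewrite ?mulr_ge0 ?(ltW h0)//; apply: ler_pM; rewrite ?(ltW h0).
have c0 : 0 <= curvature z by rewrite divr_ge0// -exprVn sqr_ge0.
have cz : curvature z * z <= 1 / 20.
  have -> : curvature z * z = z^-1 / 12 by rewrite /curvature; field; rewrite gt_eqF.
  lra.
have c1 : curvature z <= 1 / 20 by rewrite (le_trans _ cz)// ler_peMr//; lra.
set C := 1 + 8 * z ^- 3.
have [T /[!in_itv]/= /andP[T0 T2] HTz] : exists2 T, T \in `[0, 2] & profit_density C z (z - T) = 0.
  apply: IVT => //.
    apply: continuous_subspaceT => x.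
    apply: (@continuous_comp _ _ _ (fun T => z - T) (profit_density C z));
      last exact: profit_density_continuous.
    by apply: cvgB; [exact: cvg_cst|exact: cvg_id].
  have v0 : profit_density C z (z - 0) = C by rewrite /profit_density; ring.
  have v2 : profit_density C z (z - 2) = C - 2 * slope z + 4 * curvature z.
    by rewrite /profit_density; ring.
  by rewrite v0 v2 ge_min le_max; apply/andP; split; apply/orP; [right|left]; rewrite /C; lra.
have qE x : profit_density C z x = - (z - x - T) * (slope z - curvature z * (z - x + T)).
  rewrite -[LHS]subr0 -HTz /profit_density; ring.
(* The cofactor of the root is nonnegative, since [curvature z * z] is small against the slope; the
   sign of the density is that of [T - (z - x)]. *)
have gap x : 0 <= x <= z -> 0 <= slope z - curvature z * (z - x + T).
  move=> /andP[x0 xz].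
  have : curvature z * (z - x + T) <= curvature z * (z + 2) by rewrite ler_wpM2l//; lra.
  rewrite mulrDr; lra.
have zT : z - A <= z - T <= z by lra.
rewrite (integ_cat (positive_profit_lbm C z) zT).
rewrite [X in _ * (X + _)](@integ_eq _ _ (fun=> 0)); last first.
  move=> x /andP[Ax xT]; have g := gap x ltac:(lra).
  rewrite max_r ?mulr0// qE mulNr oppr_le0 mulr_ge0//; lra.
rewrite integ_cst ?mul0r ?add0r; last by case/andP: zT.
rewrite [X in _ * X](@integ_eq _ _ (fun x => x * profit_density C z x)); last first.
  move=> x /andP[Ax xT]; have g := gap x ltac:(lra).
  rewrite max_l// qE mulr_ge0//; lra.
by rewrite /profit_density integ_polynomial_reward//; apply: HT; rewrite T0.
Qed.

Variable w : R -> R.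
Hypothesis vw : value_like w.
Hypothesis wE : forall z, w z = integ (drift w) 0 z.

Lemma value_is_derive z : 0 < z -> is_derive z (1 : R) w (drift w z).
Proof.
move=> z0; rewrite [X in is_derive _ _ X](funext wE : w = integ (drift w) 0).
have := integ_derive (drift_lbm vw) (drift_continuous vw (x := z)) z0.
exact.
Qed.

Local Notation d x := (w x - expansion x).

(** States below [z - A] contribute nothing because [w] is monotone. On the window, replacing [w] by
    the expansion costs at most M - d z in the reward, hence 4 A (M - d z) after integration. *)
Lemma drift_upper : exists2 K : R, 0 <= K & forall z A M,
  20 <= z -> 2 <= A -> 1 <= z - A -> w (z - A) + 1 <= w z ->
  (forall x, z - A <= x <= z -> d x <= M) ->
  drift w z - slope z <= 4 * A * (M - d z) + K * z ^- 3.
Proof.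
have [K K0 HK] := positive_profit_integral; exists K => // z A M z20 A2 zA wA HM.
have z0 : 0 < z by lra.
have Md : 0 <= M - d z by have := HM z; rewrite lexx andbT; lra.
have [w0 wm _] := vw.
have lr c : locally_bounded_measurable (fun x => x * Num.max (w x + 1 - c) 0) by exact: reward_lbm.
rewrite /drift (@integ_cat _ _ 0 (z - A) z); [|exact: lr|by lra].
rewrite [X in _ * (X + _)](@integ_eq _ _ (fun=> 0)); last first.
  move=> x /andP[x0 xA]; rewrite max_r ?mulr0//.
  by have := wm _ _ xA; lra.
rewrite integ_cst ?mul0r ?add0r; last by lra.
set C := 1 + 8 * z ^- 3 in HK *.
have Hle : integ (fun x => x * Num.max (w x + 1 - w z) 0) (z - A) z <=
    integ (fun x => x * Num.max (profit_density C z x) 0 + z * (M - d z)) (z - A) z.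
  apply: integ_le => //.
    by apply: lbmD; [exact: positive_profit_lbm|exact: lbm_cst].
  move=> x xz; have /andP[Ax xz'] := xz.
  have x0 : 0 <= x by lra.
  apply: (@le_trans _ _ (x * (Num.max (profit_density C z x) 0 + (M - d z)))); last first.
    by rewrite mulrDr lerD2l ler_wpM2r.
  rewrite ler_wpM2l// ge_max; apply/andP; split; last first.
    by rewrite addr_ge0// le_max lexx orbT.
  have dx := HM x xz.
  have [y2|y2] := leP (z - x) 2.
    have L2 : (1 : R) <= 2 by lra.
    have y02 : 0 <= z - x <= 2 by lra.
    have z4 : 2 * 2 <= z by lra.
    have := expansion_increment L2 y02 z4; rewrite subKr ler_norml => /andP[+ _].
    have -> : (2 : R) ^+ 3 = 8 by ring.
    have : profit_density C z x <= Num.max (profit_density C z x) 0 by rewrite le_max lexx.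
    rewrite /C /profit_density; lra.
  (* For jumps longer than 2 the expansion drops by more than the reward 1, so only the deviation
     can make the term positive. *)
  have x1 : 1 <= x <= z by lra.
  have := expansion_growth x1.
  have : 0 <= Num.max (profit_density C z x) 0 by rewrite le_max lexx orbT.
  lra.
have Az : 2 <= A <= z by lra.
have := HK z A z20 Az; rewrite -/C.
move: Hle; rewrite integD; [|exact: positive_profit_lbm|exact: lbm_cst].
rewrite integ_cst; last by lra.
have z4 : 0 <= 4 / z by rewrite divr_ge0// ltW.
move=> /(ler_wpM2l z4); rewrite mulrDr.
have -> : 4 / z * (z * (M - d z) * (z - (z - A))) = 4 * A * (M - d z).
  by field; rewrite gt_eqF.
lra.
Qed.

(** Keeping only jumps of size at most T = a/2 + 1/(12 z) and dropping the positive part both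
    decrease the integral. Since T <= 2, a window of length 2 suffices and 4 T <= 8. *)
Lemma drift_lower : exists2 K : R, 0 <= K & forall z M, 20 <= z ->
  (forall x, z - 2 <= x <= z -> M <= d x) ->
  - (8 * (d z - M) + K * z ^- 3) <= drift w z - slope z.
Proof.
have [K K0 HK] := profit_bounds R; exists K => // z M z20 HM.
have z0 : 0 < z by lra.
have [_] := HK z z20; set T := a / 2 + z^-1 / 12; set C := 1 - 8 * z ^- 3 => HT.
have /andP[a1 a2] := sqrt2_bounds R.
have h0 : 0 < z^-1 by rewrite invr_gt0.
have h1 : z^-1 <= 1 / 20 by rewrite -[leRHS]invrK lef_pV2 ?posrE//; lra.
have T0 : 0 <= T by rewrite /T; lra.
have T2 : T <= 2 by rewrite /T; lra.
have Md : 0 <= d z - M by have := HM z; rewrite lexx andbT; lra.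
have lr c : locally_bounded_measurable (fun x => x * Num.max (w x + 1 - c) 0) by exact: reward_lbm.
have lp : locally_bounded_measurable (fun x => x * profit_density C z x).
  by apply: lbmM; [exact: lbm_id|apply: lbm_continuous; exact: profit_density_continuous].
have Hle : integ (fun x => x * profit_density C z x - z * (d z - M)) (z - T) z <=
    integ (fun x => x * Num.max (w x + 1 - w z) 0) (z - T) z.
  apply: integ_le => //; first by apply: lbmB => //; exact: lbm_cst.
  move=> x /andP[Tx xz]; have x0 : 0 <= x by lra.
  apply: (@le_trans _ _ (x * (profit_density C z x - (d z - M)))).
    by rewrite [leRHS]mulrBr lerD2l lerN2 ler_wpM2r.
  rewrite ler_wpM2l// le_max; apply/orP; left.
  have dx : M <= d x by apply: HM; lra.
  have L2 : (1 : R) <= 2 by lra.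
  have y02 : 0 <= z - x <= 2 by lra.
  have z4 : 2 * 2 <= z by lra.
  have := expansion_increment L2 y02 z4; rewrite subKr ler_norml => /andP[_].
  have -> : (2 : R) ^+ 3 = 8 by ring.
  rewrite /C /profit_density; lra.
have Hcat : integ (fun x => x * Num.max (w x + 1 - w z) 0) (z - T) z <=
    integ (fun x => x * Num.max (w x + 1 - w z) 0) 0 z.
  rewrite (@integ_cat _ _ 0 (z - T) z); [|exact: lr|by lra].
  rewrite lerDr; apply: integ_ge0 => x /andP[x0 _].
  by rewrite mulr_ge0// le_max lexx orbT.
move: (le_trans Hle Hcat); rewrite integB//; last exact: lbm_cst.
rewrite integ_cst; last by lra.
rewrite /profit_density integ_polynomial_reward// -/(profit C z T).
have z4 : 0 <= 4 / z by rewrite divr_ge0// ltW.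
move=> /(ler_wpM2l z4); rewrite mulrBr -/(drift w z).
have -> : 4 / z * (z * (d z - M) * (z - (z - T))) = 4 * T * (d z - M).
  by field; rewrite gt_eqF.
have : 4 * T * (d z - M) <= 8 * (d z - M) by rewrite ler_wpM2r//; lra.
lra.
Qed.

End DriftBounds.

(** * Expansion of the value and of the threshold *)

Section ValueExpansion.
Variable R : realType.
Implicit Types (c h k p q s x y z A L M T : R).
Local Notation a := (Num.sqrt (2 : R)).
Variable w : R -> R.
Hypothesis vw : value_like w.
Hypothesis wE : forall z, w z = integ (drift w) 0 z.
Local Notation d x := (w x - expansion x).

Lemma value_expansion : exists c K S : R, [/\ 0 <= K, 20 <= S &
  forall z, S <= z -> `|w z - (expansion z + c)| <= K * z ^- 2].
Proof.
have [KU KU0 HU] := drift_upper vw; have [KL KL0 HL] := drift_lower vw.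
pose f x := d x; pose df x := drift w x - slope x.
have dF z : 20 <= z -> is_derive z (1 : R) f (df z).
  move=> z20; have z0 : 0 < z by lra.
  exact: derive_sub (value_is_derive vw wE z0) (expansion_is_derive z0).
have one20 : (1 : R) <= 20 by lra.
have [D1 HD1] : exists D, forall z, 20 <= z -> f z <= D.
  apply: (@bounded_above_of_max_principle _ f df 20 KU one20 KU0 dF) => z z22 Hz.
  (* The whole past from 20 on is the window: at a running maximum M = d z, so its unbounded length
     does no harm. *)
  have -> : KU * z ^- 3 = 4 * (z - 20) * (f z - d z) + KU * z ^- 3.
    by rewrite /f subrr mulr0 add0r.
  apply: HU; rewrite ?subKr//; try lra.
    have := Hz 20; rewrite lexx /f; have := @expansion_growth _ 20 z; lra.
have [D2 HD2] : exists D, forall z, 20 <= z -> - f z <= D.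
  apply: (@bounded_above_of_max_principle _ (fun x => - f x) (fun x => - df x) 20 KL one20 KL0).
    by move=> z /dF dz; exact: derive_opp dz.
  move=> z z22 Hz.
  have Hz' x : z - 2 <= x <= z -> d z <= d x.
    by move=> xz; have := Hz x; rewrite /f; lra.
  by have := HL z (d z) ltac:(lra) Hz'; rewrite subrr mulr0 add0r lerNl.
pose D := Num.max `|D1| `|D2|.
have fD z : 20 <= z -> `|f z| <= D.
  move=> z20; have := HD1 z z20; have := HD2 z z20.
  have : D1 <= D by rewrite le_max ler_norm.
  have : D2 <= D by rewrite le_max ler_norm orbT.
  by rewrite ler_norml; lra.
have D0 : 0 <= D by rewrite le_max normr_ge0.
(* With |d| <= D, the value grows by at least A - 2 D = 2 over a window, so jumps longer than [A]
   never pay. *)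
pose A := 2 * D + 2; pose C := KU + KL + 1.
have C0 : 0 < C by rewrite /C; lra.
have A1 : 1 <= A by rewrite /A; lra.
have A2 : 2 <= A by rewrite /A; lra.
have k0 : 0 <= 4 * A by rewrite mulr_ge0//; lra.
have jump z : 20 + A <= z -> w (z - A) + 1 <= w z.
  move=> zA; have := fD z ltac:(lra); have := fD (z - A) ltac:(lra).
  have := @expansion_growth _ (z - A) z ltac:(lra).
  by rewrite !ler_norml /f /A; lra.
have CU : KU <= C by rewrite /C; lra.
have CL : KL <= C by rewrite /C; lra.
clearbody A C D; have i3 z : 20 <= z -> 0 <= z ^- 3 by move=> z20; rewrite invr_ge0 exprn_ge0//; lra.
have HU' z N : 20 + A <= z -> (forall x, z - A <= x <= z -> f x <= N) ->
    df z <= 4 * A * (N - f z) + C * z ^- 3.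
  move=> zA HN; have := HU z A N ltac:(lra) A2 ltac:(lra) (jump z zA) HN.
  move/le_trans; apply; rewrite lerD2l ler_wpM2r ?i3//; lra.
have HL' z N : 20 + A <= z -> (forall x, z - A <= x <= z -> N <= f x) ->
    - (4 * A * (f z - N) + C * z ^- 3) <= df z.
  move=> zA HN; have HN' x : z - 2 <= x <= z -> N <= d x.
    by move=> xz; apply: HN; lra.
  apply: le_trans (HL z N ltac:(lra) HN'); rewrite lerN2 lerD//.
    by rewrite ler_wpM2r//; [have := HN z; rewrite /f; lra|lra].
  by rewrite ler_wpM2r ?i3//; lra.
have [K [S [S20 HS]]] := oscillation_decay A1 k0 C0 one20 dF HU' HL' fD.
(* Beyond [S2] one has z - A >= z/2, and the factor 8 converts (z - A)^-3 into z^-3. *)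
pose K' := 8 * (4 * A * `|K|) + C; pose S2 := S + 2 * A.
have K'0 : 0 <= K' by rewrite addr_ge0 ?(ltW C0)// !mulr_ge0//; lra.
have [||||c Hc] := @convergence_of_cubic_derivative _ f df S2 K'.
- by rewrite /S2; lra.
- exact: K'0.
- by move=> z; rewrite /S2 => zS; apply: dF; lra.
- move=> z; rewrite /S2 => zS.
  have [m [M [HmM Mm]]] := HS (z - A) ltac:(lra).
  have zA : 20 + A <= z by lra.
  have HM x : z - A <= x <= z -> f x <= M.
    by move=> xz; have /andP[] := HmM x ltac:(lra).
  have Hm x : z - A <= x <= z -> m <= f x.
    by move=> xz; have /andP[] := HmM x ltac:(lra).
  have /andP[mz zM] := HmM z ltac:(lra).
  have gapb : M - m <= 8 * `|K| * z ^- 3.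
    apply: (le_trans Mm); apply: (@le_trans _ _ (`|K| * (z - A) ^- 3)).
      by rewrite ler_wpM2r ?ler_norm// invr_ge0 exprn_ge0//; lra.
    rewrite [8 * _]mulrC -mulrA ler_wpM2l//.
    have -> : 8 * z ^- 3 = (z / 2) ^- 3 by field; lra.
    by rewrite lef_pV2 ?posrE ?exprn_gt0 ?lerXn2r ?nnegrE//; lra.
  have u := HU' z M zA HM; have l := HL' z m zA Hm.
  have b1 : 4 * A * (M - f z) <= 4 * A * (8 * `|K| * z ^- 3) by rewrite ler_wpM2l//; lra.
  have b2 : 4 * A * (f z - m) <= 4 * A * (8 * `|K| * z ^- 3) by rewrite ler_wpM2l//; lra.
  have e : K' * z ^- 3 = 4 * A * (8 * `|K| * z ^- 3) + C * z ^- 3 by rewrite /K'; ring.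
  by rewrite ler_norml e; lra.
exists c, K', S2; split => //; first by rewrite /S2; lra.
move=> z Sz; have -> : w z - (expansion z + c) = f z - c by rewrite /f; ring.
exact: Hc.
Qed.

(** The constant [c] cancels in w(z) - w(z - y) = 1, which leaves (a - h/6) y = 1 + O(h^2) with h =
    1/z, once [y] is known to be bounded. *)
Lemma threshold_expansion : exists K S : R, forall z y, S <= z -> 0 <= y <= z ->
  w (z - y) + 1 - w z = 0 -> `|y - (a^-1 + (12 * z)^-1)| <= K * z ^- 2.
Proof.
have [c [K [S [K0 S20 HS]]]] := value_expansion.
(* If y > A, the value would drop by at least A - 2 K = 2. In [K2], the term 5 K collects the errors
   of [w] at [z] and at z - y >= z/2, A^3 the Taylor error, A^2 the curvature and A the last term of
   the slope. *)
pose A := 2 * K + 2; pose K2 := 5 * K + A ^+ 3 + A ^+ 2 + A.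
exists (K2 + 1), (2 * S + 2 * A) => z y zS /andP[y0 yz] /eqP.
have A2 : 2 <= A by rewrite /A; lra.
have z0 : 0 < z by lra.
have sq1 x : S <= x -> x ^- 2 <= 1.
  by move=> Sx; rewrite invf_le1 ?exprn_gt0 ?exprn_ege1//; lra.
have HS' x : S <= x -> `|w x - (expansion x + c)| <= K.
  by move=> Sx; rewrite (le_trans (HS x Sx))// ler_piMr// sq1.
have [_ wm _] := vw.
have yA : y <= A \/ A < y by case: (leP y A); [left|right].
case: yA => [yA|Ay]; last first.
  have H1 := HS' z ltac:(lra); have H2 := HS' (z - A) ltac:(lra).
  have H3 := @expansion_growth _ (z - A) z ltac:(lra).
  have H4 := wm (z - y) (z - A) ltac:(lra).
  move: H1 H2; rewrite !ler_norml => H1 H2 /eqP H5; exfalso.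
  suff : 1 < 1 :> R by rewrite ltxx.
  by move: H3; rewrite /A in H2 H4 *; lra.
clearbody A; move=> /eqP Hy.
have y2 : z / 2 <= z - y by lra.
have H1 := HS z ltac:(lra); have H2 := HS (z - y) ltac:(lra).
have A1 : 1 <= A by lra.
have yb : 0 <= y <= A by rewrite y0.
have zA : 2 * A <= z by lra.
have H3 := expansion_increment A1 yb zA.
pose h := z^-1.
have hz : z^-1 = h by [].
have h0 : 0 < h by rewrite invr_gt0.
have h1 : h <= 1 by rewrite /h invf_le1//; lra.
have hE : z ^- 2 = h ^+ 2 by rewrite exprVn.
have h3E : z ^- 3 = h ^+ 3 by rewrite exprVn.
have h32 : h ^+ 3 <= h ^+ 2 by rewrite exprS ler_piMl ?sqr_ge0.
have h20 : 0 <= h ^+ 2 by rewrite sqr_ge0.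
have H2' : `|w (z - y) - (expansion (z - y) + c)| <= 4 * K * h ^+ 2.
  apply: (le_trans H2); rewrite [4 * K]mulrC -mulrA ler_wpM2l//.
  have -> : 4 * h ^+ 2 = (z / 2) ^- 2 by rewrite /h; field; lra.
  by rewrite lef_pV2 ?posrE ?exprn_gt0 ?lerXn2r ?nnegrE//; lra.
clearbody h; have /andP[a1 a2] := sqrt2_bounds R.
have yy : y ^+ 2 <= A ^+ 2 by rewrite lerXn2r ?nnegrE; lra.
have c1 : 0 <= curvature z * y ^+ 2 <= A ^+ 2 * h ^+ 2.
  rewrite /curvature hE; have c2 : h ^+ 2 / 12 <= h ^+ 2 by lra.
  apply/andP; split; first by rewrite mulr_ge0 ?sqr_ge0//; lra.
  by rewrite mulrC ler_pM ?sqr_ge0//; lra.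
have c2 : A ^+ 3 * h ^+ 3 <= A ^+ 3 * h ^+ 2 by rewrite ler_wpM2l// exprn_ge0//; lra.
have c3 : 0 <= a * h ^+ 2 / 144 * y <= A * h ^+ 2.
  have e1 : 0 <= a * h ^+ 2 by rewrite mulr_ge0//; lra.
  have e2 : a * h ^+ 2 <= 2 * h ^+ 2 by rewrite ler_wpM2r//; lra.
  apply/andP; split; first by rewrite mulr_ge0//; lra.
  by rewrite mulrC ler_pM//; lra.
have key : `|(a - h / 6) * y - 1| <= K2 * h ^+ 2.
  have e : slope z * y = (a - h / 6) * y - a * h ^+ 2 / 144 * y.
    by rewrite /slope hE hz; ring.
  move: H1 H2' H3; rewrite hE h3E e /K2 !ler_norml.
  move=> /andP[? ?] /andP[? ?] /andP[? ?]; apply/andP; split; lra.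
have -> : a^-1 + (12 * z)^-1 = a / 2 + h / 12.
  have an : a != 0 by rewrite gt_eqF//; lra.
  by rewrite invfM hz; have := sqrt2_sqr R; move=> e; field: e.
have s1 : 1 <= a - h / 6 by lra.
have : `|(a - h / 6) * (y - (a / 2 + h / 12))| <= (K2 + 1) * h ^+ 2.
  (* The claimed value inverts the slope to second order: (a - h/6)(a/2 + h/12) = 1 - h^2/72. *)
  have -> : (a - h / 6) * (y - (a / 2 + h / 12)) = (a - h / 6) * y - 1 + h ^+ 2 / 72.
    by field: (sqrt2_sqr R).
  rewrite [leRHS]mulrDl mul1r (le_trans (ler_normD _ _))// lerD//.
  by rewrite ger0_norm; lra.
rewrite hE normrM ger0_norm; last by lra.
by apply: le_trans; rewrite ler_peMl.
Qed.

End ValueExpansion.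

(** * The jump chain of a controlled process *)

Section ControlledProcess.
Variable R : realType.
Implicit Types (f g : R -> R) (a b c k x y z : R).
Local Notation lbm := (@locally_bounded_measurable R).

(** A control is unconstrained off (0, +oo); cutting off there gives functions that are measurable
    and locally bounded on the whole line. *)
Definition on_pos f x := if 0 < x then f x else 0.

Lemma on_posE f x : 0 < x -> on_pos f x = f x.
Proof. by rewrite /on_pos => ->. Qed.

Lemma lbm_on_pos f : measurable_fun (`]0, +oo[ : set R) f ->
  (forall B : R, exists C : R, forall x, 0 < x <= B -> `|f x| <= C) ->
  lbm (on_pos f).
Proof.
move=> mf bf; split.
  have -> : on_pos f = f \_ (`]0, +oo[ : set R).
    apply/funext => x; rewrite /on_pos patchE; case: ifPn => x0.
      by rewrite mem_set//= in_itv /= x0.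
    by rewrite memNset//= in_itv /= andbT; exact/negP.
  exact: (measurable_restrictT f (measurable_itv `]0, +oo[)).1.
move=> B; have [C HC] := bf B; exists `|C| => x xB; rewrite /on_pos.
case: ifPn => x0; last by rewrite normr0.
by rewrite (le_trans _ (ler_norm C))// HC// x0 (le_trans _ xB)// ler_norm.
Qed.

Lemma measurable_inv_pos : measurable_fun (`]0, +oo[ : set R) (fun x : R => x^-1).
Proof.
apply: open_continuous_measurable_fun; first exact: interval_open.
move=> x; rewrite inE /= in_itv /= andbT => x0.
by apply: cvgV; [rewrite gt_eqF|exact: cvg_id].
Qed.

Variable theta : R -> R.
Hypothesis ctheta : control_function theta.

Lemma control_bounds x : 0 < x -> 0 < theta x <= x.
Proof. by case: ctheta => _; exact. Qed.

Definition rate := on_pos (jump_rate theta).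

Lemma lambda_gt0 x : 0 < x -> 0 < lambda theta x.
Proof.
move=> x0; have /andP[t0 tx] := control_bounds x0.
have -> : lambda theta x = theta x * (1 - theta x / x / 2).
  by rewrite /lambda; field; rewrite gt_eqF.
have : theta x / x <= 1 by rewrite ler_pdivrMr// mul1r.
by move=> t1; rewrite mulr_gt0//; lra.
Qed.

Lemma rate_bounds x : 0 < x -> 0 <= rate x <= 2 * x.
Proof.
move=> x0; have l0 := lambda_gt0 x0.
rewrite /rate on_posE// /jump_rate mulr_ge0 ?(ltW l0)//=.
have -> : 2 * x = 4 * lambda theta x + 2 * (x - theta x) ^+ 2 / x.
  by rewrite /lambda; field; rewrite gt_eqF.
rewrite lerDl; apply: mulr_ge0; last by rewrite invr_ge0 ltW.
by rewrite mulr_ge0 ?sqr_ge0.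
Qed.

Lemma rate_ge0 x : 0 <= rate x.
Proof.
have [x0|x0] := ltP 0 x; first by have /andP[] := rate_bounds x0.
by rewrite /rate /on_pos ltNge x0.
Qed.

Lemma rate_lbm : lbm rate.
Proof.
have [mt _] := ctheta.
apply: lbm_on_pos => [|B].
  have -> : jump_rate theta = fun x => 4 * (theta x - (theta x * theta x) * (2^-1 * x^-1)).
    by apply/funext => x; rewrite /jump_rate /lambda expr2 invfM.
  apply: measurable_funM; first exact: measurable_cst.
  apply: measurable_funB => //; apply: measurable_funM; first exact: measurable_funM.
  by apply: measurable_funM; [exact: measurable_cst|exact: measurable_inv_pos].
exists (2 * B) => x /andP[x0 xB]; rewrite -[jump_rate _ _](on_posE _ x0) -/rate.
have /andP[r0 r2] := rate_bounds x0.
by rewrite ger0_norm; lra.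
Qed.

Definition cumulated_rate z := integ rate 0 z.

Lemma cumulated_rate_continuous : continuous cumulated_rate.
Proof. exact: integ_continuous rate_lbm. Qed.

Lemma survival_lbm : lbm (fun x => expR (cumulated_rate x)).
Proof.
apply: lbm_continuous => x; apply: continuous_comp; last exact: continuous_expR.
exact: cumulated_rate_continuous.
Qed.

(** Separating the variables turns the kernel into an exponential factor times an integral with
    running upper limit, to which an integrating factor applies. *)
Lemma survivalE z x : 0 < x <= z ->
  survival theta z x = expR (cumulated_rate x) * expR (- cumulated_rate z).
Proof.
move=> /andP[x0 xz]; rewrite -expRD; congr expR.
have -> : cumulated_rate z = cumulated_rate x + integ rate x z.
  by rewrite /cumulated_rate (integ_cat rate_lbm (b := x)) ?(ltW x0).
rewrite -/(integ (jump_rate theta) x z) (@integ_eq _ _ rate); first by lra.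
by move=> s /andP[xs _]; rewrite /rate on_posE// (lt_le_trans x0).
Qed.

(** The jump rate times the mean of [f] after the jump, written over the landing state; [lambda]
    cancels. *)
Definition jump_gain f x := 4 / x * integ (fun s => s * f s) (x - theta x) x.

Lemma continuous_Xmul f : continuous f -> continuous (fun s : R => s * f s).
Proof. by move=> cf x; apply: cvgM; [exact: cvg_id|exact: cf]. Qed.

(** The lower limit depends on a merely measurable [theta]; the integral is measurable as a
    difference of values of a continuous primitive, one of them composed with [x - theta x]. *)
Lemma jump_gain_lbm f : continuous f -> lbm (on_pos (jump_gain f)).
Proof.
move=> cf; have [mt _] := ctheta.
have lf := lbm_continuous (continuous_Xmul cf).
pose Phi := integ (fun s => s * f s) 0.
have mPhi : measurable_fun [set: R] Phi.
  by apply: continuous_measurable_fun; exact: integ_continuous.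
apply: lbm_on_pos => [|B].
  apply: (@eq_measurable_fun _ _ _ _ _ (fun x => 4 * x^-1 * (Phi x - Phi (x - theta x)))).
    move=> x; rewrite inE /= in_itv /= andbT => x0.
    have /andP[t0 tx] := control_bounds x0.
    rewrite /jump_gain /Phi; congr (_ * _).
    rewrite (integ_cat lf (a := 0) (b := x - theta x)); first by rewrite addrC addKr.
    by lra.
  apply: measurable_funM.
    by apply: measurable_funM; [exact: measurable_cst|exact: measurable_inv_pos].
  apply: measurable_funB; first exact: measurable_funTS.
  apply: measurableT_comp => //; apply: measurable_funB => //.
have [C HC] := (lbm_continuous cf).2 B.
exists (4 * `|C| * B) => x /andP[x0 xB]; have /andP[t0 tx] := control_bounds x0.
have z4 : 0 <= 4 / x by rewrite divr_ge0// ltW.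
rewrite /jump_gain normrM ger0_norm//.
apply: (@le_trans _ _ (4 / x * (x * `|C| * (x - (x - theta x))))).
  rewrite ler_wpM2l//; apply: integ_norm_le => //; first by lra.
  move=> s /andP[ts sx]; have s0 : 0 <= s by lra.
  rewrite normrM ger0_norm// ler_pM// (le_trans _ (ler_norm C))// HC//.
  by rewrite ger0_norm//; lra.
have -> : 4 / x * (x * `|C| * (x - (x - theta x))) = 4 * `|C| * theta x.
  by field; rewrite gt_eqF.
by rewrite ler_wpM2l ?mulr_ge0//; lra.
Qed.

(** The real-valued form of [jump_kernel]. It preserves continuity even for discontinuous controls,
    so it can be iterated. *)
Definition kernel f z :=
  expR (- cumulated_rate z) * integ (fun x => expR (cumulated_rate x) * on_pos (jump_gain f) x) 0 z.

Lemma kernel_integrand_lbm f : continuous f ->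
  lbm (fun x => expR (cumulated_rate x) * on_pos (jump_gain f) x).
Proof. by move=> cf; apply: lbmM; [exact: survival_lbm|exact: jump_gain_lbm]. Qed.

Lemma kernel_continuous f : continuous f -> continuous (kernel f).
Proof.
move=> cf x; apply: cvgM; last exact: integ_continuous (kernel_integrand_lbm cf) _.
apply: continuous_comp; last exact: continuous_expR.
by apply: cvgN; exact: cumulated_rate_continuous.
Qed.

Lemma jump_kernelE f z : continuous f ->
  jump_kernel theta (fun x => (f x)%:E) z = (kernel f z)%:E.
Proof.
move=> cf; have lk := kernel_integrand_lbm cf.
rewrite /jump_kernel.
have E x : (`]0, z]%classic : set R) x -> ((jump_rate theta x * survival theta z x)%:E *
      \int[lebesgue_measure]_(y in `[0%R, theta x])
         ((f (x - y))%:E * (jump_density theta x y)%:E))%E =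
   (expR (- cumulated_rate z) * (expR (cumulated_rate x) * on_pos (jump_gain f) x))%:E.
  rewrite /= in_itv /= => /andP[x0 xz]; have /andP[t0 tx] := control_bounds x0.
  have l0 := lambda_gt0 x0.
  (* As 1 - y/x = (x - y)/x, the jump density depends on the landing state only, and [integ_shift]
     applies. *)
  pose F s := (x * lambda theta x)^-1 * (s * f s).
  have cF : continuous F.
    by move=> s; apply: cvgM; [exact: cvg_cst|exact: continuous_Xmul].
  have cFs : continuous (fun y => F (x - y)).
    move=> y; apply: (@continuous_comp _ _ _ (fun y => x - y) F); last exact: cF.
    by apply: cvgB; [exact: cvg_cst|exact: cvg_id].
  have -> : (\int[lebesgue_measure]_(y in `[0%R, theta x])
      ((f (x - y))%:E * (jump_density theta x y)%:E) =
    \int[lebesgue_measure]_(y in `[0%R, theta x]) (F (x - y))%:E)%E.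
    apply: eq_integral => y _; rewrite -EFinM; congr EFin.
    by rewrite /F /jump_density; field; rewrite !gt_eqF.
  have iF := lbm_integrable 0 (theta x) (lbm_continuous cFs).
  have fF : (\int[lebesgue_measure]_(y in `[0%R, theta x]) (F (x - y))%:E)%E \is a fin_num.
    by apply: integrable_fin_num => //; exact: iF.
  rewrite -[X in (_ * X)%E]fineK//= -EFinM; congr EFin.
  rewrite -/(Rintegral _ _ _) -/(integ (fun y => F (x - y)) 0 (theta x)).
  rewrite (integ_shift x cF (ltW t0)) /F integZ; last exact: lbm_continuous (continuous_Xmul cf).
  rewrite survivalE ?x0// on_posE// /jump_gain /jump_rate.
  by field; rewrite !gt_eqF.
transitivity (\int[lebesgue_measure]_(x in `]0%R, z]) (expR (- cumulated_rate z) *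
    (expR (cumulated_rate x) * on_pos (jump_gain f) x))%:E)%E.
  by apply: eq_integral => x /set_mem /E.
have lk' := lbmM (lbm_cst (expR (- cumulated_rate z))) lk.
have ik := lbm_integrable 0 z lk'.
rewrite integral_itv_obnd_cbnd; last first.
  by apply/measurable_EFinP; apply: measurable_funTS; case: lk'.
rewrite -[LHS]fineK; last by apply: integrable_fin_num => //; exact: ik.
by congr EFin; rewrite /kernel -integZ.
Qed.

Lemma jump_gainD f g : continuous f -> continuous g ->
  jump_gain (fun x => f x + g x) = fun x => jump_gain f x + jump_gain g x.
Proof.
move=> cf cg; apply/funext => x; rewrite /jump_gain -mulrDr -integD.
- by congr (_ * _); apply: integ_eq => s _; rewrite mulrDr.
- exact: lbm_continuous (continuous_Xmul cf).
- exact: lbm_continuous (continuous_Xmul cg).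
Qed.

Lemma kernelD f g z : continuous f -> continuous g ->
  kernel (fun x => f x + g x) z = kernel f z + kernel g z.
Proof.
move=> cf cg; rewrite /kernel -mulrDr -integD; [|exact: kernel_integrand_lbm..].
congr (_ * _); apply: integ_eq => x _; rewrite jump_gainD// -mulrDr /on_pos.
by case: ifPn => // _; rewrite addr0.
Qed.

Lemma kernelZ k f z : continuous f -> kernel (fun x => k * f x) z = k * kernel f z.
Proof.
move=> cf; rewrite /kernel [RHS]mulrCA; congr (_ * _).
rewrite -integZ; last exact: kernel_integrand_lbm.
apply: integ_eq => x _; rewrite /on_pos; case: ifPn => _; last by rewrite !mulr0.
rewrite [RHS]mulrCA; congr (_ * _); rewrite /jump_gain [RHS]mulrCA; congr (_ * _).
rewrite -integZ; last exact: lbm_continuous (continuous_Xmul cf).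
by apply: integ_eq => s _; rewrite mulrCA.
Qed.

Lemma kernel_le f g z : continuous f -> continuous g ->
  (forall x, 0 <= x <= z -> f x <= g x) -> kernel f z <= kernel g z.
Proof.
move=> cf cg fg; rewrite /kernel; apply: ler_wpM2l; first exact: expR_ge0.
apply: integ_le; [exact: kernel_integrand_lbm..|].
move=> x /andP[x0 xz]; apply: ler_wpM2l; first exact: expR_ge0.
rewrite /on_pos; case: ifPn => // {}x0.
have /andP[t0 tx] := control_bounds x0.
have z4 : 0 <= 4 / x by rewrite divr_ge0// ltW.
rewrite /jump_gain ler_wpM2l//; apply: integ_le.
- exact: lbm_continuous (continuous_Xmul cf).
- exact: lbm_continuous (continuous_Xmul cg).
- move=> s /andP[ts sx]; have s0 : 0 <= s by lra.
  by rewrite ler_wpM2l// fg// s0 (le_trans sx).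
Qed.

Fixpoint tail_prob n : R -> R := if n is n'.+1 then kernel (tail_prob n') else fun=> 1.

Lemma tail_prob_continuous n : continuous (tail_prob n).
Proof.
elim: n => [|n IH] /=; last exact: kernel_continuous.
by move=> x; exact: cvg_cst.
Qed.

Lemma prob_jumps_geE n : prob_jumps_ge theta n = fun z => (tail_prob n z)%:E.
Proof.
elim: n => [//|n IH]; rewrite /prob_jumps_ge iterS -/(prob_jumps_ge theta n) IH.
by apply/funext => z; rewrite jump_kernelE//; exact: tail_prob_continuous.
Qed.

Lemma kernel0 z : kernel (fun=> 0) z = 0.
Proof.
have c0 : continuous (fun _ : R => (0 : R)) by move=> x; exact: cvg_cst.
have -> : (fun=> 0) = (fun x : R => 0 * (fun=> (0 : R)) x) by apply/funext => x; rewrite mul0r.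
by rewrite (kernelZ 0)// mul0r.
Qed.

Lemma tail_prob_ge0 n z : 0 <= tail_prob n z.
Proof.
elim: n z => [|n IH] z /=; first exact: ler01.
rewrite -(kernel0 z); apply: kernel_le => //; last exact: tail_prob_continuous.
by move=> x; exact: cvg_cst.
Qed.

(** E[min(N, n)], obtained by conditioning on the first jump. *)
Fixpoint partial_mean n : R -> R :=
  if n is n'.+1 then kernel (fun x => 1 + partial_mean n' x) else fun=> 0.

Lemma continuous_add1 f : continuous f -> continuous (fun x => 1 + f x).
Proof. by move=> cf x; apply: cvgD; [exact: cvg_cst|exact: cf]. Qed.

Lemma partial_mean_continuous n : continuous (partial_mean n).
Proof.
elim: n => [|n IH] /=; last exact: kernel_continuous (continuous_add1 IH).
by move=> x; exact: cvg_cst.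
Qed.

Lemma partial_meanS n z : partial_mean n.+1 z = partial_mean n z + tail_prob n.+1 z.
Proof.
elim: n z => [|n IH] z.
  by rewrite /= add0r; congr (kernel _ z); apply/funext => x; rewrite addr0.
have E : (fun x => 1 + partial_mean n.+1 x) =
    (fun x => (1 + partial_mean n x) + tail_prob n.+1 x).
  by apply/funext => x; rewrite IH addrA.
change (kernel (fun x => 1 + partial_mean n.+1 x) z =
  kernel (fun x => 1 + partial_mean n x) z + kernel (tail_prob n.+1) z).
rewrite E kernelD//; last exact: tail_prob_continuous.
by apply: continuous_add1; exact: partial_mean_continuous.
Qed.

Lemma partial_meanE n z : (partial_mean n z)%:E = (\sum_(1 <= i < n.+1) prob_jumps_ge theta i z)%E.
Proof.
elim: n => [|n IH]; first by rewrite big_geq.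
rewrite partial_meanS EFinD IH [RHS]big_nat_recr//.
by congr (_ + _)%E; rewrite prob_jumps_geE.
Qed.

Lemma prob_jumps_ge_ge0 n z : (0 <= prob_jumps_ge theta n z)%E.
Proof. by rewrite prob_jumps_geE lee_fin tail_prob_ge0. Qed.

Lemma expected_jumps_le z (M : R) : (forall n, partial_mean n z <= M) ->
  (expected_jumps theta z <= M%:E)%E.
Proof.
move=> HM; apply: lime_le.
  by apply: is_cvg_nneseries => n _ _; exact: prob_jumps_ge_ge0.
apply: nearW => -[|n]; last by rewrite -partial_meanE lee_fin.
by rewrite big_geq// lee_fin -[X in X <= _](erefl (partial_mean 0 z)).
Qed.

Lemma partial_mean_le n z : ((partial_mean n z)%:E <= expected_jumps theta z)%E.
Proof.
rewrite partial_meanE; apply: nneseries_lim_ge => i _ _; exact: prob_jumps_ge_ge0.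
Qed.

End ControlledProcess.

(** * Verification *)

Section Verification.
Variable R : realType.
Implicit Types (f g : R -> R) (a b c k x y z : R).
Local Notation lbm := (@locally_bounded_measurable R).

(* Halving the interval [m] times divides the bound by [2 ^ m]. *)
Lemma quadratic_increments_cst f (B C : R) : 0 <= B ->
  (forall a b, 0 <= a -> a <= b -> b <= B -> `|f b - f a| <= C * (b - a) ^+ 2) ->
  f B = f 0.
Proof.
move=> B0 H; apply/eqP; rewrite -subr_eq0 -normr_eq0 eq_le normr_ge0 andbT.
apply: (@le0_geometric _ _ (C * B ^+ 2)) => n.
suff : forall a b, 0 <= a -> a <= b -> b <= B -> `|f b - f a| <= C * (b - a) ^+ 2 * 2 ^- n.
  by move=> /(_ 0 B (lexx _) B0 (lexx _)); rewrite subr0.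
elim: n => [|n IH] a b a0 ab bB; first by rewrite expr0 invr1 mulr1 H.
pose m := (a + b) / 2.
have am : a <= m by rewrite /m; lra.
have mb : m <= b by rewrite /m; lra.
have := IH a m a0 am (le_trans mb bB).
have := IH m b (le_trans a0 am) mb bB.
have -> : C * (b - a) ^+ 2 * 2 ^- n.+1 =
    C * (b - m) ^+ 2 * 2 ^- n + C * (m - a) ^+ 2 * 2 ^- n.
  rewrite [2 ^+ n.+1]exprS invfM /m; field.
  by rewrite expf_eq0 /= pnatr_eq0 andbF.
move=> h1 h2; have -> : f b - f a = (f b - f m) + (f m - f a) by ring.
by rewrite (le_trans (ler_normD _ _))// lerD.
Qed.

Lemma expR_increment x y : x <= y ->
  expR x * (y - x) <= expR y - expR x <= expR y * (y - x).
Proof.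
move=> xy; have yE : expR y = expR x * expR (y - x) by rewrite -expRD; congr expR; ring.
have xE : expR x = expR y * expR (- (y - x)) by rewrite -expRD; congr expR; ring.
have h1 := ler_wpM2l (expR_ge0 x) (expR_ge1Dx (y - x)).
have h2 := ler_wpM2l (expR_ge0 y) (expR_ge1Dx (- (y - x))).
rewrite -yE in h1; rewrite -xE in h2.
apply/andP; split; lra.
Qed.

(** A discrete product rule: [D] plays the increment of the logarithm of the first factor, and
    monotonicity encloses both integrals between end point values, up to terms quadratic in [q]. *)
Lemma product_increment_bound (ea eb L D q wa wb wz I1 I2 : R) :
  0 <= eb <= L -> 0 <= D <= q -> 0 <= wb - wa <= q -> 0 <= wa <= wz ->
  ea * D <= eb - ea <= eb * D ->
  ea * (wb - wa) <= I1 <= eb * (wb - wa) -> ea * wa * D <= I2 <= eb * wb * D ->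
  `|I1 + I2 - (eb * wb - ea * wa)| <= L * (q * q) * (1 + wz).
Proof.
move=> /andP[eb0 ebL] /andP[D0 Dq] /andP[W0 Wq] /andP[wa0 waz] /andP[De1 De2].
move=> /andP[H1 H1'] /andP[H2 H2'].
have P1 : eb * (D * (wb - wa)) <= L * (q * q).
  by apply: ler_pM => //; [rewrite mulr_ge0|apply: ler_pM].
have P2 : eb * (D * D) * wa <= L * (q * q) * wz.
  apply: ler_pM => //; first by rewrite !mulr_ge0.
  by apply: ler_pM => //; [rewrite mulr_ge0|apply: ler_pM].
have Q1 : (eb - ea) * (wb - wa) <= eb * D * (wb - wa) by rewrite ler_wpM2r.
have Q2 : (eb - ea) * D * wa <= eb * D * D * wa by rewrite !ler_wpM2r.
have Q3 : ea * D * wa <= (eb - ea) * wa by rewrite ler_wpM2r.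
have Q4 : (eb - ea) * wa <= eb * D * wa by rewrite ler_wpM2r.
by rewrite ler_norml; apply/andP; split; lra.
Qed.

(* [e * w] is differentiable only almost everywhere, as [r] is merely measurable;
   its increments agree with those of the integral up to second order. *)
Lemma integrating_factor_identity (e r w dw : R -> R) (z m : R) : 0 <= z -> 0 <= m ->
  lbm e -> lbm r -> lbm w -> lbm dw -> w 0 = 0 ->
  (forall x, 0 <= e x) -> (forall x, 0 <= w x) ->
  (forall x, 0 <= x <= z -> 0 <= r x <= m) ->
  (forall x, 0 <= x <= z -> 0 <= dw x <= m) ->
  (forall a b, 0 <= a -> a <= b -> w b - w a = integ dw a b) ->
  (forall a b, 0 <= a -> a <= b ->
    e a * integ r a b <= e b - e a <= e b * integ r a b) ->
  integ (fun x => e x * (dw x + r x * w x)) 0 z = e z * w z.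
Proof.
move=> z0 m0 le lr lw ld w0 e0 wpos rb db wi ei.
pose psi x := e x * (dw x + r x * w x).
have lpsi : lbm psi by apply: lbmM => //; apply: lbmD => //; exact: lbmM.
pose F x := integ psi 0 x - e x * w x.
suff FE : F z = F 0.
  have F0 : F 0 = 0 by rewrite /F integ_point w0 mulr0 subr0.
  by apply/eqP; rewrite -subr_eq0; apply/eqP; rewrite -[RHS]F0 -FE.
have bound f a b : lbm f -> (forall x, 0 <= x <= z -> 0 <= f x <= m) ->
    0 <= a -> a <= b -> b <= z -> 0 <= integ f a b <= m * (b - a).
  move=> lf fb a0 ab bz; rewrite integ_ge0 => [|x /andP[ax xb]]; last first.
    by have /andP[] := fb x ltac:(lra).
  rewrite (le_trans (ler_norm _))//; apply: integ_norm_le => // x /andP[ax xb].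
  by have /andP[f0 fm] := fb x ltac:(lra); rewrite ger0_norm.
have emono a b : 0 <= a -> a <= b -> b <= z -> e a <= e b.
  move=> a0 ab bz; have /andP[I0 _] := bound r a b lr rb a0 ab bz.
  have /andP[h _] := ei a b a0 ab; rewrite -subr_ge0 (le_trans _ h)//.
  by rewrite mulr_ge0.
have wmono a b : 0 <= a -> a <= b -> b <= z -> w a <= w b.
  by move=> a0 ab bz; rewrite -subr_ge0 wi//; have /andP[] := bound dw a b ld db a0 ab bz.
apply: (@quadratic_increments_cst _ _ (e z * m * m * (1 + w z)) z0) => a b a0 ab bz.
have l1 : lbm (fun x => e x * dw x) by exact: lbmM.
have l2 : lbm (fun x => e x * (r x * w x)) by apply: lbmM => //; exact: lbmM.
have ldk k : lbm (fun x => k * dw x) by exact: lbmM (lbm_cst k) ld.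
have lrk k : lbm (fun x => k * r x) by exact: lbmM (lbm_cst k) lr.
have -> : e z * m * m * (1 + w z) * (b - a) ^+ 2 =
  e z * ((m * (b - a)) * (m * (b - a))) * (1 + w z) by ring.
have -> : F b - F a = integ (fun x => e x * dw x) a b +
    integ (fun x => e x * (r x * w x)) a b - (e b * w b - e a * w a).
  rewrite -integD// [X in _ = X - _](@integ_eq _ _ psi) => [|x _]; last by rewrite /psi mulrDr.
  have ab0 : 0 <= a <= b by rewrite a0.
  by rewrite /F (integ_cat lpsi ab0); ring.
apply: (@product_increment_bound _ _ (e z) (integ r a b)).
- by rewrite e0 emono// (le_trans a0).
- exact: bound.
- by rewrite wi//; exact: bound.
- by rewrite wpos wmono// (le_trans ab).
- exact: ei.
- rewrite wi// -!integZ//; apply/andP; split.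
    apply: (integ_le (ldk _) l1) => x /andP[ax xb].
    have xz : x <= z by exact: le_trans bz.
    have /andP[d0 _] := db x ltac:(lra).
    by rewrite ler_wpM2r// emono.
  apply: (integ_le l1 (ldk _)) => x /andP[ax xb].
  have /andP[d0 _] := db x ltac:(lra).
  by rewrite ler_wpM2r// emono//; lra.
- rewrite -!integZ//; apply/andP; split.
    apply: (integ_le (lrk _) l2) => x /andP[ax xb]; rewrite -mulrA [r x * w x]mulrC.
    have xz : x <= z by exact: le_trans bz.
    have /andP[r0 _] := rb x ltac:(lra).
    have h2 : w a * r x <= w x * r x by rewrite ler_wpM2r// wmono.
    by apply: ler_pM h2 => //; [rewrite mulr_ge0|exact: emono].
  apply: (integ_le l2 (lrk _)) => x /andP[ax xb]; rewrite -mulrA [r x * w x]mulrC.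
  have x0 : 0 <= x by lra.
  have /andP[r0 _] := rb x ltac:(lra).
  have h2 : w x * r x <= w b * r x by rewrite ler_wpM2r// wmono.
  by apply: ler_pM h2 => //; [rewrite mulr_ge0|exact: emono].
Qed.

Variable w : R -> R.
Hypothesis vw : value_like w.
Hypothesis wE : forall z, w z = integ (drift w) 0 z.

Lemma value_increment a b : 0 <= a -> a <= b -> w b - w a = integ (drift w) a b.
Proof.
move=> a0 ab; rewrite !wE (integ_cat (drift_lbm vw) (b := a)) ?a0//.
by rewrite addrC addKr.
Qed.

Lemma value_lbm : lbm w.
Proof. by apply: lbm_continuous; exact: value_like_continuous. Qed.

Lemma value_ge0 z : 0 <= w z.
Proof. by rewrite wE; apply: integ_ge0 => x _; exact: drift_ge0. Qed.

Section FixedControl.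
Variable theta : R -> R.
Hypothesis ctheta : control_function theta.
Local Notation r := (rate theta).
Local Notation Lam := (cumulated_rate theta).

Lemma cumulated_rate_increment a b : 0 <= a -> a <= b -> Lam b - Lam a = integ r a b.
Proof.
move=> a0 ab; rewrite /cumulated_rate (integ_cat (rate_lbm ctheta) (b := a)) ?a0//.
by rewrite addrC addKr.
Qed.

Lemma integrating_factor z : 0 <= z ->
  integ (fun x => expR (Lam x) * (drift w x + r x * w x)) 0 z = expR (Lam z) * w z.
Proof.
move=> z0; have [w0 wm _] := vw.
apply: (@integrating_factor_identity (fun x => expR (Lam x)) r w (drift w) z (2 * z)) => //.
- by rewrite mulr_ge0.
- exact: survival_lbm.
- exact: rate_lbm.
- exact: value_lbm.
- exact: drift_lbm.
- exact: w0.
- exact: value_ge0.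
- move=> x /andP[x0 xz]; rewrite rate_ge0//=; have [x0'|x0'] := ltP 0 x.
    by have /andP[_ h] := rate_bounds ctheta x0'; rewrite (le_trans h)// ler_wpM2l.
  by rewrite /rate /on_pos ltNge x0' mulr_ge0.
- move=> x /andP[x0 xz]; rewrite drift_ge0//= (le_trans (drift_le vw x0))//.
  by rewrite ler_wpM2l.
- exact: value_increment.
- move=> a b a0 ab; rewrite -cumulated_rate_increment//; apply: expR_increment.
  rewrite -subr_ge0 cumulated_rate_increment//; apply: integ_ge0 => x _; exact: rate_ge0.
Qed.

Lemma reward_lower_lbm x : lbm (fun s => s * (w s + 1 - w x)).
Proof.
have cw := value_like_continuous vw.
apply: lbm_continuous; apply: continuous_Xmul => s; apply: cvgB; last exact: cvg_cst.
by apply: cvgD; [exact: cw|exact: cvg_cst].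
Qed.

(** Subtracting the current value [w x] from the reward isolates the surplus, which is what
    [drift w x] maximizes. *)
Lemma jump_gain_value x : 0 < x -> jump_gain theta (fun s => 1 + w s) x =
  r x * w x + 4 / x * integ (fun s => s * (w s + 1 - w x)) (x - theta x) x.
Proof.
move=> x0; have /andP[t0 tx] := control_bounds ctheta x0.
have lm := reward_lower_lbm x.
have rE : r x = 4 / x * integ id (x - theta x) x.
  rewrite /rate on_posE// integ_id; last by lra.
  by rewrite /jump_rate /lambda; field; rewrite gt_eqF.
have lwx : lbm (fun s => w x * s) by exact: lbmM (lbm_cst (w x)) (lbm_id R).
transitivity (4 / x * (w x * integ id (x - theta x) x +
    integ (fun s => s * (w s + 1 - w x)) (x - theta x) x)); last by rewrite rE; ring.
rewrite -integZ; last exact: lbm_id.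
by rewrite -integD// /jump_gain; congr (_ * _); apply: integ_eq => s _; ring.
Qed.

Lemma jump_gain_value_le x : 0 < x ->
  jump_gain theta (fun s => 1 + w s) x <= drift w x + r x * w x.
Proof.
move=> x0; rewrite jump_gain_value// addrC lerD2r.
have /andP[t0 tx] := control_bounds ctheta x0.
have z4 : 0 <= 4 / x by rewrite divr_ge0// ltW.
rewrite /drift ler_wpM2l// (integ_cat (reward_lbm (w x) vw) (b := x - theta x)); last by lra.
rewrite (@le_trans _ _ (integ (fun s => s * Num.max (w s + 1 - w x) 0) (x - theta x) x))//.
  apply: integ_le; [exact: reward_lower_lbm|exact: reward_lbm|].
  move=> s /andP[ts sx]; have s0 : 0 <= s by lra.
  by rewrite ler_wpM2l// le_max lexx.
rewrite lerDr; apply: integ_ge0 => s /andP[s0 _].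
by rewrite mulr_ge0// le_max lexx orbT.
Qed.

Lemma drift_rate_lbm : lbm (fun x => expR (Lam x) * (drift w x + r x * w x)).
Proof.
apply: lbmM; first exact: survival_lbm.
by apply: lbmD; [exact: drift_lbm|apply: lbmM; [exact: rate_lbm|exact: value_lbm]].
Qed.

Lemma value_add1_continuous : continuous (fun s => 1 + w s).
Proof. by apply: continuous_add1; exact: value_like_continuous. Qed.

Lemma kernel_value_le z : 0 <= z -> kernel theta (fun s => 1 + w s) z <= w z.
Proof.
move=> z0; have -> : w z = expR (- Lam z) * (expR (Lam z) * w z).
  by rewrite mulrA -expRD addNr expR0 mul1r.
rewrite -integrating_factor// /kernel ler_wpM2l ?expR_ge0//; apply: integ_le.
- exact: kernel_integrand_lbm value_add1_continuous.
- exact: drift_rate_lbm.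
- move=> x /andP[x0 xz]; rewrite ler_wpM2l ?expR_ge0// /on_pos; case: ifPn => [{}x0|_].
    exact: jump_gain_value_le.
  by rewrite addr_ge0 ?drift_ge0// mulr_ge0 ?rate_ge0 ?value_ge0.
Qed.

Lemma partial_mean_le_value n z : 0 <= z -> partial_mean theta n z <= w z.
Proof.
elim: n z => [|n IH] z z0 /=; first exact: value_ge0.
apply: le_trans (kernel_value_le z0); apply: kernel_le => //.
- by apply: continuous_add1; exact: partial_mean_continuous.
- exact: value_add1_continuous.
- by move=> x /andP[x0 _]; rewrite lerD2l IH.
Qed.

Lemma expected_jumps_le_value z : 0 <= z -> (expected_jumps theta z <= (w z)%:E)%E.
Proof. by move=> z0; apply: expected_jumps_le => // n; exact: partial_mean_le_value. Qed.

(** Under this condition [jump_gain_value_le] becomes an equality and [w] a fixed point of the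
    one-jump equation. *)
Hypothesis optimal : forall x, 0 < x ->
  integ (fun s => s * (w s + 1 - w x)) (x - theta x) x =
  integ (fun s => s * Num.max (w s + 1 - w x) 0) 0 x.

Lemma kernel_value z : 0 <= z -> kernel theta (fun s => 1 + w s) z = w z.
Proof.
move=> z0; have -> : w z = expR (- Lam z) * (expR (Lam z) * w z).
  by rewrite mulrA -expRD addNr expR0 mul1r.
rewrite -integrating_factor// /kernel; congr (_ * _); apply: integ_eq => x /andP[x0 xz].
congr (_ * _); rewrite /on_pos; case: ifPn => [{}x0|].
  by rewrite jump_gain_value// optimal// addrC.
rewrite -leNgt => x0'; rewrite drift_le0// /rate /on_pos ltNge x0' /=.
by rewrite mul0r addr0.
Qed.

(** By linearity the remainder after n + 1 steps is the kernel applied to the remainder after n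
    steps, so it is the n-th iterate of the kernel on [w]. *)
Lemma value_sub_partial_mean n z : 0 <= z ->
  w z - partial_mean theta n z <= w z * tail_prob theta n z.
Proof.
(* The factor [w z] stays fixed while [y] varies: the kernel at [y] only sees states in [0, y]. *)
suff H y : 0 <= y <= z -> w y - partial_mean theta n y <= w z * tail_prob theta n y.
  by move=> z0; apply: H; rewrite z0 lexx.
have cw := value_like_continuous vw.
elim: n y => [|n IH] y /andP[y0 yz] /=; first by rewrite subr0 mulr1; case: vw => _ + _; exact.
rewrite -{1}(kernel_value y0).
have cp := partial_mean_continuous ctheta (n := n).
have ct := tail_prob_continuous ctheta (n := n).
have cd : continuous (fun x => w x - partial_mean theta n x).
  by move=> x; apply: cvgB; [exact: cw|exact: cp].
have := kernelD ctheta y (continuous_add1 cp) cd.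
have -> : (fun x => 1 + partial_mean theta n x + (w x - partial_mean theta n x)) = fun x => 1 + w x.
  by apply/funext => x; ring.
move=> ->; rewrite addrC addKr.
rewrite -(@kernelZ _ _ ctheta (w z) _ y ct); apply: (kernel_le ctheta cd).
  by move=> x; apply: cvgM; [exact: cvg_cst|exact: ct].
by move=> x /andP[x0 xy]; apply: IH; rewrite x0 (le_trans xy).
Qed.

Lemma partial_mean_ge n z e : 0 <= z -> (forall i, (0 < i <= n)%N -> e <= tail_prob theta i z) ->
  n%:R * e <= partial_mean theta n z.
Proof.
move=> z0; elim: n => [_|n IH H]; first by rewrite mul0r.
rewrite partial_meanS// -natr1 mulrDl mul1r lerD//; last by rewrite H//= leqnn.
by apply: IH => i /andP[i0 ni]; rewrite H// i0 ltnW.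
Qed.

(** Some tail probability is small: otherwise the partial means, which are sums of tails, would
    exceed their bound [w z]. *)
Lemma expected_jumps_ge_value z : 0 <= z -> ((w z)%:E <= expected_jumps theta z)%E.
Proof.
move=> z0; apply/lee_addgt0Pr => e e0.
have [i Hi] : exists i, w z * tail_prob theta i z <= e.
  apply: contrapT => /forallNP Hn.
  have wz : 0 < w z.
    rewrite lt_neqAle value_ge0 andbT; apply/eqP => wz0.
    by apply: (Hn 0%N); rewrite -wz0 mul0r ltW.
  have ew : 0 < e / w z by rewrite divr_gt0.
  pose n := (Num.truncn (w z / (e / w z))).+1.
  have := @partial_mean_ge n z (e / w z) z0.
  have H i : (0 < i <= n)%N -> e / w z <= tail_prob theta i z.
    by move=> _; rewrite ler_pdivrMr// mulrC; apply/ltW; rewrite ltNge; apply/negP; exact: Hn.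
  move=> /(_ H) /le_trans /(_ (partial_mean_le_value n z0)).
  apply/negP; rewrite -ltNge -ltr_pdivrMr//; exact: truncnS_gt.
have := partial_mean_le ctheta i z; have := value_sub_partial_mean i z0.
move=> h1 h2; have h3 : w z <= partial_mean theta i z + e by lra.
by rewrite (le_trans (y := (partial_mean theta i z + e)%:E)) ?lee_fin// EFinD leeD2r.
Qed.

End FixedControl.

Lemma optimal_control_exists : exists2 theta, control_function theta &
  forall x, 0 < x ->
  integ (fun s => s * (w s + 1 - w x)) (x - theta x) x =
  integ (fun s => s * Num.max (w s + 1 - w x) 0) 0 x.
Proof.
have [w0 wm wl] := vw; have cw := value_like_continuous vw.
(* The admissible jump sizes. This set is an interval starting at 0, so its supremum describes
   it. *)
pose S x := [set y | 0 <= y <= x /\ w x <= w (x - y) + 1].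
pose th x := sup (S x).
have S0 x : 0 < x -> S x 0.
  by move=> x0; split; [rewrite lexx ltW|rewrite subr0; lra].
have ubS x : ubound (S x) x by move=> y [/andP[]].
have thx x : 0 < x -> 0 <= th x <= x.
  move=> x0; apply/andP; split.
    by apply: ub_le_sup; [exists x; exact: ubS|exact: S0].
  by apply: ge_sup; [exists 0; exact: S0|exact: ubS].
have Sth x : 0 < x -> w x <= w (x - th x) + 1.
  move=> x0; have /andP[t0 tx] := thx x x0.
  rewrite leNgt; apply/negP => h.
  (* The supremum is attained: by the slope bound [2 * x], a point of [S x] within [e] of it would
     already close the assumed gap. *)
  pose e := (w x - (w (x - th x) + 1)) / (2 * x).
  have e0 : 0 < e by rewrite divr_gt0 ?mulr_gt0//; lra.
  have hs : has_sup (S x) by split; [exists 0; exact: S0|exists x; exact: ubS].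
  have [y [/andP[y0 yx] Sy] ty] := sup_adherent e0 hs.
  have yth : y <= th x.
    by apply: ub_le_sup; [exists x; exact: ubS|split=> //; rewrite y0].
  have := wl (x - th x) (x - y); rewrite subr_ge0 tx lerD2l lerN2 yth => /(_ isT).
  have : 2 * (x - y) * (x - y - (x - th x)) <= 2 * x * (th x - y).
    have -> : x - y - (x - th x) = th x - y by ring.
    by rewrite ler_wpM2r//; lra.
  have : 2 * x * (th x - y) < 2 * x * e.
    by rewrite ltr_pM2l ?mulr_gt0//; move: ty; rewrite -/(th x); lra.
  have -> : 2 * x * e = w x - (w (x - th x) + 1) by rewrite /e; field; rewrite gt_eqF.
  lra.
have Sdown x y : 0 < x -> 0 <= y <= th x -> S x y.
  move=> x0 /andP[y0 yt]; have /andP[t0 tx] := thx x x0.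
  split; first by rewrite y0 (le_trans yt).
  by apply: (le_trans (Sth x x0)); rewrite lerD2r wm// lerD2l lerN2.
have th_gt0 x : 0 < x -> 0 < th x.
  (* By the slope bound, a jump of size 1/(2 x) loses at most 1, so it is admissible. *)
  move=> x0; pose y := Num.min x (2 * x)^-1.
  have y0 : 0 < y by rewrite lt_min x0 invr_gt0 mulr_gt0.
  have yx : y <= x by rewrite ge_min lexx.
  apply: (lt_le_trans y0); apply: ub_le_sup; first by exists x; exact: ubS.
  split; first by rewrite yx ltW.
  have := wl (x - y) x; rewrite subr_ge0 yx lerBlDr lerDl (ltW y0) => /(_ isT).
  have -> : x - (x - y) = y by ring.
  have : 2 * x * y <= 1.
    have h : y <= (2 * x)^-1 by rewrite ge_min lexx orbT.
    have x2 : 0 < 2 * x by rewrite mulr_gt0.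
    by rewrite mulrC -ler_pdivlMr// mul1r.
  lra.
exists th.
  split; last by move=> x x0; rewrite th_gt0//; have /andP[] := thx x x0.
  move=> mD; apply: (measurability _ (RGenCInfty.measurableE R)) => // _ [_ [c ->] <-].
  have [c0|c0] := ltP c 0.
    have -> : (`]0, +oo[ `&` th @^-1` `[c, +oo[)%classic = `]0, +oo[%classic :> set R.
      apply/seteqP; split=> x [] //=; rewrite !in_itv /= !andbT => x0.
      by split=> //; have /andP[t0 _] := thx x x0; rewrite ?in_itv /= ?andbT; lra.
    exact: measurable_itv.
  pose G x := w x - w (x - c).
  have cG : continuous G.
    move=> x; apply: cvgB; first exact: cw.
    apply: (@continuous_comp _ _ _ (fun x => x - c) w); last exact: cw.
    by apply: cvgB; [exact: cvg_id|exact: cvg_cst].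
  (* The control reaches [c] exactly when a jump of size [c] is admissible, which is a closed
     condition on [x]. *)
  have -> : (`]0, +oo[ `&` th @^-1` `[c, +oo[)%classic =
      ((`]0, +oo[ `&` `[c, +oo[) `&` (G @^-1` `]-oo, 1]))%classic :> set R.
    apply/seteqP; split=> x /=.
      rewrite !in_itv /= !andbT => -[x0 cx].
      have [] := Sdown x c x0; first by rewrite c0.
      by rewrite /G => /andP[_ cx'] h; split=> //; lra.
    rewrite !in_itv /= !andbT => -[[x0 cx] h]; split=> //.
    apply: ub_le_sup; first by exists x; exact: ubS.
    by split; [rewrite c0|move: h; rewrite /G; lra].
  apply: measurableI; first by apply: measurableI; exact: measurable_itv.
  rewrite -[X in measurable X]setTI.
  by apply: continuous_measurable_fun => //; exact: measurable_itv.
move=> x x0; have /andP[t0 tx] := thx x x0.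
rewrite [RHS](integ_cat (reward_lbm (w x) vw) (b := x - th x)); last by lra.
rewrite [X in _ = X + _](_ : _ = 0) ?add0r; last first.
  have [txe|txn] := eqVneq (th x) x; first by rewrite txe subrr integ_point.
  have txl : th x < x by rewrite lt_neqAle txn.
  have wx1 : 1 < w x.
    rewrite ltNge; apply/negP => wx1; have : x <= th x.
      apply: ub_le_sup; first by exists x; exact: ubS.
      by split; [rewrite lexx ltW|rewrite subrr (w0 0 (lexx _)); lra].
    by rewrite leNgt txl.
  (* The state [s] where the value is exactly [w x - 1] bounds [x - th x] from above, so below
     [x - th x] the reward is not positive. *)
  have [s /[!in_itv]/= /andP[s0 sx] ws] : exists2 s, s \in `[0, x] & w s = w x - 1.
    apply: IVT; [exact: ltW|exact: continuous_subspaceT|].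
    by rewrite (w0 0 (lexx _)) ge_min le_max; apply/andP; split; apply/orP; [left|right]; lra.
  have xs : x - s <= th x.
    apply: ub_le_sup; first by exists x; exact: ubS.
    by split; [lra|rewrite subKr ws; lra].
  rewrite (@integ_eq _ _ (fun=> 0)) ?integ_cst ?mul0r//; first by lra.
  move=> y /andP[y0 yt]; rewrite max_r ?mulr0//.
  by have := wm y s ltac:(lra); lra.
apply: integ_eq => s /andP[ts sx]; rewrite max_l//.
have [_] := Sdown x (x - s) x0 ltac:(lra).
by rewrite subKr; lra.
Qed.

Lemma optimal_valueE z : 0 <= z -> optimal_value z = w z.
Proof.
move=> z0; have [theta ctheta opt] := optimal_control_exists.
suff -> : optimal_value z = fine (w z)%:E by [].
congr fine; apply/eqP; rewrite eq_le; apply/andP; split.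
  by apply: ge_ereal_sup => _ [th cth <-]; exact: expected_jumps_le_value.
apply: (le_trans (expected_jumps_ge_value ctheta opt z0)).
by apply: ereal_sup_ubound; exists theta.
Qed.

End Verification.

(** * Transfer to the optimal value and control in Landau notation *)

Lemma bigO_of_bound (R : realType) (f : R -> R) (K S : R) :
  (forall z, S <= z -> `|f z| <= K * z ^- 2) ->
  f =O_ (pinfty_nbhs R) (fun z : R => z ^- 2).
Proof.
move=> H; apply/eqOP; near=> k; near=> z.
have Sz : S <= z by near: z; exact: nbhs_pinfty_ge (num_real _).
have Kk : K <= k by near: k; exact: nbhs_pinfty_ge (num_real _).
have z2 : 0 <= z ^- 2 by rewrite -exprVn sqr_ge0.
by rewrite (ger0_norm z2) (le_trans (H z Sz))// ler_wpM2r.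
Unshelve. all: by end_near. Qed.

Theorem theorem5 (R : realType) :
  ((fun z : R => optimal_control z - ((Num.sqrt 2)^-1 + (12 * z)^-1))
     =O_ (pinfty_nbhs R) (fun z : R => z ^- 2)) /\
  (exists c : R,
     (fun z : R => optimal_value z -
        (Num.sqrt 2 * z - 6^-1 * ln z + c + Num.sqrt 2 / (144 * z)))
     =O_ (pinfty_nbhs R) (fun z : R => z ^- 2)).
Proof.
have [w vw wE] := optimality_equation_solvable R.
have vE := optimal_valueE vw wE.
have [c [K [S [K0 S20 HS]]]] := value_expansion vw wE.
split; last first.
  exists c; apply: (@bigO_of_bound R _ K S) => z Sz.
  rewrite vE; last by lra.
  have := HS z Sz; rewrite /expansion.
  by have -> : Num.sqrt 2 * z - 6^-1 * ln z + c + Num.sqrt 2 / (144 * z) =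
    Num.sqrt 2 * z - 6^-1 * ln z + Num.sqrt 2 / (144 * z) + c by ring.
have [K1 [S1 HS1]] := threshold_expansion vw wE.
(* The second entry forces [w z > 1], so that [optimal_control] takes its second branch. *)
pose S2 := Num.max S1 (S + (K + `|expansion 1 + c| + 2)).
apply: (@bigO_of_bound R _ K1 S2) => z; rewrite ge_max => /andP[S1z Sz].
have n0 : 0 <= `|expansion (1 : R) + c| by [].
have z20 : 20 <= z by lra.
have z0 : 0 <= z by lra.
have w1 : 1 < w z.
  have Sz' : S <= z by lra.
  have z2 : z ^- 2 <= 1 by rewrite invf_le1 ?exprn_gt0 ?exprn_ege1//; lra.
  have := HS z Sz'; have := @expansion_growth R 1 z ltac:(lra).
  have := ler_wpM2l K0 z2; rewrite mulr1.
  have : - (expansion 1 + c) <= `|expansion (1 : R) + c| by rewrite -normrN ler_norm.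
  by rewrite !ler_norml; lra.
rewrite /optimal_control (vE z z0) ifF; last by apply/negbTE; rewrite -ltNge.
set A := [set y | _].
have w00 : w 0 = 0 by case: vw => -> //.
(* A solution must exist, or [xget] would return its default [z]; [threshold_expansion] then applies
   to whichever solution is selected. *)
have [y Ay] : exists y, A y.
  have [s /[!in_itv]/= /andP[s0 sz] ws] : exists2 s, s \in `[0, z] & w s = w z - 1.
    apply: IVT => //.
      by apply: continuous_subspaceT; exact: value_like_continuous.
    by rewrite w00 ge_min le_max; apply/andP; split; apply/orP; [left|right]; lra.
  exists (z - s); split; first by lra.
  by rewrite vE subKr ?ws//; lra.
have [/andP[x0 xz]] := xgetPex z (ex_intro _ y Ay).
rewrite vE; last by rewrite subr_ge0.
by move=> /HS1; apply => //; rewrite x0.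
Qed.
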